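(* Let $K=2$, $\Delta y=\Delta x$, and let $\mathcal E$ be the evolution matrix of the Discontinuous Galerkin method of degree $2$ for two-dimensional linear acoustics with the Rusanov flux, i.e. with $D_x=D_y$ equal to the $3\times 3$ identity matrix. Let $\mathbf k=(k_x,k_y)\in\mathbb R^2$ be fixed with $k_xk_y\ne0$, and let $\hat Q=(-k_y,k_x,0)^{\mathrm T}$. Then there exists a selectively optimal projector $\pi_{\mathbf k}$ onto $\ker\mathcal E$ such that $$\widehat{\mathrm{DOF}}(\hat Q)-\pi_{\mathbf k}\widehat{\mathrm{DOF}}(\hat Q)\in\mathcal O(\Delta x^{2})\qquad(\Delta x\to0),$$ i.e. it is possible to obtain second order of accuracy at stationary state.
   Context: Linear acoustics in 2D with variables $q=(u,v,p)$: $\partial_t q+J_x\partial_x q+J_y\partial_y q=0$ with $$J_x=\begin{pmatrix}0&0&1\\0&0&0\\1&0&0\end{pmatrix},\qquad J_y=\begin{pmatrix}0&0&0\\0&0&1\\0&1&0\end{pmatrix}.$$ Note $\hat Q=(-k_y,k_x,0)^{\mathrm T}$ spans $\ker(J_xk_x+J_yk_y)$ for $\mathbf k\neq0$. Basis: $b_0,\dots,b_K$ is the $L^2(-\frac12,\frac12)$-orthonormal polynomial basis with $\deg b_k=k$ ($b_0=1$, $b_1=2\sqrt3x$, $b_2=\frac{\sqrt5}{2}(12x^2-1)$), so the mass matrix is $M^k_\alpha=\delta_{k\alpha}$. Put $G^k_\alpha=\int_{-1/2}^{1/2}b_k'(\xi)b_\alpha(\xi)\,d\xi$. Numerical fluxes: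 $\hat f^x(q_L,q_R)=J_x\frac{q_L+q_R}{2}-D_x\frac{q_R-q_L}{2}$, and analogously $\hat f^y$ with $J_y,D_y$. Evolution matrix: let $t_x=e^{\mathrm ik_x\Delta x}$, $t_y=e^{\mathrm ik_y\Delta y}$. Inserting $q_{ij}^{(\alpha\beta)}(t)=\hat q^{(\alpha\beta)}(t)t_x^it_y^j$ (with $\hat q^{(\alpha\beta)}\in\mathbb C^3$) in the semi-discrete DG method of tensor-product degree $K$ yields $\frac{d}{dt}\hat q^{(k\ell)}+\sum_{\alpha,\beta=0}^K\mathcal E^{k\ell}_{\alpha\beta}\hat q^{(\alpha\beta)}=0$, where the $3\times3$ blocks of $\mathcal E\in\mathbb C^{3(K+1)^2\times3(K+1)^2}$ are $$\begin{aligned}\mathcal E^{k\ell}_{\alpha\beta}=&-\tfrac1{\Delta x}J_xM^\ell_\beta G^k_\alpha-\tfrac1{\Delta y}J_yM^k_\alpha G^\ell_\beta\\&+\frac{b_k(\frac12)t_x-b_k(-\frac12)}{t_x\Delta x}\left(J_x\frac{b_\alpha(\frac12)+t_xb_\alpha(-\frac12)}2-D_x\frac{t_xb_\alpha(-\frac12)-b_\alpha(\frac12)}2\right)M^\ell_\beta\\&+\frac{b_\ell(\frac12)t_y-b_\ell(-\frac12)}{t_y\Delta y}\left(J_y\frac{b_\beta(\frac12)+t_yb_\beta(-\frac12)}2-D_y\frac{t_yb_\beta(-\frac12)-b_\beta(\frac12)}2\right)M^k_\alpha .\end{aligned}$$ Degrees of freedom of the Fourier mode $\hat Q e^{\mathrm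 i\mathbf k\cdot\mathbf x}$: for $0\le k,\ell\le K$, $$\widehat{\mathrm{DOF}}(\hat Q)_{k\ell}=\hat Q\,\frac1{\Delta x\Delta y}\int_{-\Delta x/2}^{\Delta x/2}\int_{-\Delta y/2}^{\Delta y/2}b_k\!\left(\tfrac x{\Delta x}\right)b_\ell\!\left(\tfrac y{\Delta y}\right)e^{\mathrm ik_xx}e^{\mathrm ik_yy}\,dy\,dx\in\mathbb C^3 .$$ Selectively optimal projector: a map (more precisely, a family of maps depending on $\Delta x$) $\pi_{\mathbf k}:\mathbb C^{3(K+1)^2}\to\ker\mathcal E$, not required to be linear or idempotent (it may be affine), for which there is an index set $I\subset\{1,\dots,3(K+1)^2\}$, independent of $\Delta x$, with $\#I=\dim\ker\mathcal E$ for all small $\Delta x$ and $(\pi_{\mathbf k}\hat q)_i=\hat q_i+\mathcal O(\Delta x^{K+1})$ as $\Delta x\to0$ for all $i\in I$ and all $\hat q\in\mathbb C^{3(K+1)^2}$. *)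

(* Defs.v *)
From HB Require Import structures.
From mathcomp Require Import all_boot all_order all_algebra.
From mathcomp Require Import complex.
From mathcomp Require Import all_classical all_reals all_analysis.

Set Implicit Arguments.
Unset Strict Implicit.
Unset Printing Implicit Defensive.

Import Order.TTheory GRing.Theory Num.Theory.
Import numFieldNormedType.Exports.

Local Open Scope classical_set_scope.
Local Open Scope ring_scope.
Local Open Scope complex_scope.

(* The components of a state q are ordered (u, v, p). *)
Definition Jx (R : realType) : 'M[R[i]]_3 :=
  \matrix_(r, c) (nth [::] [:: [:: 0; 0; 1];
                               [:: 0; 0; 0];
                               [:: 1; 0; 0]] r)`_c.

Definition Jy (R : realType) : 'M[R[i]]_3 :=
  \matrix_(r, c) (nth [::] [:: [:: 0; 0; 0];
                               [:: 0; 0; 1];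
                               [:: 0; 1; 0]] r)`_c.

Definition Qhat (R : realType) (kx ky : R) : 'cV[R[i]]_3 :=
  \col_r [:: (- ky)%:C; kx%:C; 0]`_r.

(* exp(i theta), by Euler's formula. *)
Definition expi (R : realType) (theta : R) : R[i] := cos theta +i* sin theta.

Definition cintegral (R : realType) (a b : R) (f : R -> R[i]) : R[i] :=
  (\int[lebesgue_measure]_(x in `[a, b]) complex.Re (f x)) +i*
  (\int[lebesgue_measure]_(x in `[a, b]) complex.Im (f x)).

(* The L^2(-1/2, 1/2)-orthonormal polynomials b_0, b_1, b_2. *)
Definition basis2 (R : realType) (k : 'I_3) : {poly R} :=
  [:: 1;
      (2 * Num.sqrt 3) *: 'X;
      (Num.sqrt 5 / 2) *: (12 *: 'X^2 - 1)]`_k.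

Section DG.
Context (R : realType) (K : nat) (b : 'I_K.+1 -> {poly R}).

Definition massM (k a : 'I_K.+1) : R :=
  \int[lebesgue_measure]_(x in `[(- 2^-1 : R), 2^-1]) ((b k).[x] * (b a).[x]).

Definition gradG (k a : 'I_K.+1) : R :=
  \int[lebesgue_measure]_(x in `[(- 2^-1 : R), 2^-1]) (((b k)^`()).[x] * (b a).[x]).

Definition bR (k : 'I_K.+1) : R[i] := (b k).[2^-1]%:C.
Definition bL (k : 'I_K.+1) : R[i] := (b k).[- 2^-1]%:C.

(* The contribution of the numerical fluxes through the two cell interfaces in
   one direction, t being the translation factor exp(i k d) for mesh width d. *)
Definition fluxTerm (J D : 'M[R[i]]_3) (t : R[i]) (d : R) (k a : 'I_K.+1) :
    'M[R[i]]_3 :=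
  ((bR k * t - bL k) / (t * d%:C)) *:
    (((bR a + t * bL a) / 2) *: J - ((t * bL a - bR a) / 2) *: D).

Definition evolBlock (Dx Dy : 'M[R[i]]_3) (kx ky dx dy : R)
    (k l a c : 'I_K.+1) : 'M[R[i]]_3 :=
  - (dx^-1 * massM l c * gradG k a)%:C *: Jx R
  - (dy^-1 * massM k a * gradG l c)%:C *: Jy R
  + (massM l c)%:C *: fluxTerm (Jx R) Dx (expi (kx * dx)) dx k a
  + (massM k a)%:C *: fluxTerm (Jy R) Dy (expi (ky * dy)) dy l c.

End DG.

(* A degree of freedom is a triple (k, l, m): the tensor-product basis function
   b_k b_l and the component m of q.  Vectors and matrices are indexed by the
   library's enumeration of these triples. *)
Definition dof (K : nat) : finType := ('I_K.+1 * 'I_K.+1 * 'I_3)%type.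

Definition ndof (K : nat) : nat := #|dof K|.

Lemma ndofE K : ndof K = (3 * K.+1 ^ 2)%N.
Proof. by rewrite /ndof !card_prod !card_ord mulnC. Qed.

Definition evolMx (R : realType) (K : nat) (b : 'I_K.+1 -> {poly R})
    (Dx Dy : 'M[R[i]]_3) (kx ky dx dy : R) : 'M[R[i]]_(ndof K) :=
  \matrix_(r, s)
    let: (k, l, m) := enum_val r : dof K in
    let: (a, c, n) := enum_val s : dof K in
    evolBlock b Dx Dy kx ky dx dy k l a c m n.

Definition dofMode (R : realType) (K : nat) (b : 'I_K.+1 -> {poly R})
    (kx ky dx dy : R) (Q : 'cV[R[i]]_3) : 'cV[R[i]]_(ndof K) :=
  \col_r
    let: (k, l, m) := enum_val r : dof K in
    Q m 0 * ((dx * dy)^-1)%:C *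
    cintegral (- (dx / 2)) (dx / 2) (fun x =>
      cintegral (- (dy / 2)) (dy / 2) (fun y =>
        (b k).[x / dx]%:C * (b l).[y / dy]%:C *
        expi (kx * x) * expi (ky * y))).

Definition mxker (R : realType) (N : nat) (A : 'M[R[i]]_N) :
    {vspace 'cV[R[i]]_N} :=
  lker (linfun (mulmx A) : 'End('cV[R[i]]_N)).

(* f(h) = O(h^n) as h -> 0+, for complex-valued f. *)
Definition isO_pow (R : realType) (f : R -> R[i]) (n : nat) : Prop :=
  (fun h : R => Normc.normc (f h)) =O_ (0^'+) (fun h : R => h ^+ n).

(* E and P are families indexed by the mesh width h > 0; the index set I and
   the threshold hidden in "near" do not depend on q, whereas the constant in
   the O may. *)
Definition selectively_optimal (R : realType) (K : nat)
    (E : R -> 'M[R[i]]_(ndof K))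
    (P : R -> 'cV[R[i]]_(ndof K) -> 'cV[R[i]]_(ndof K)) : Prop :=
  (forall h, 0 < h -> forall q, P h q \in mxker (E h)) /\
  exists I : {set 'I_(ndof K)},
    (\forall h \near 0^'+, #|I| = \dim (mxker (E h))) /\
    (forall i, i \in I -> forall q : 'cV[R[i]]_(ndof K),
       isO_pow (fun h => P h q i 0 - q i 0) K.+1).

(* Main.v *)
Require Import Defs.
From mathcomp Require Import all_boot all_order all_algebra.
From mathcomp Require Import complex.
From mathcomp Require Import all_classical all_reals all_analysis.
From mathcomp Require Import ring lra.
Import Order.TTheory GRing.Theory Num.Theory.
Import numFieldNormedType.Exports.

(* In matrix notation for the coefficients of u, v, p, the dissipative part of
   the scheme is positive semidefinite and the central part is skew-Hermitian by
   summation by parts. Pairing a stationary state with itself therefore kills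
   the dissipation, i.e. u, v, p have no jumps across the cell interfaces; on
   such states the scheme acts as the exact derivative of piecewise polynomials.
   Hence p = 0 and u_x + v_y = 0, which for K = 2 forces u_x and v_y to be
   multiples of l(x) l(y), with l the quasi-periodic continuous piecewise linear
   function. The kernel is thus a line, spanned by u = - sy q(x) l(y),
   v = sx l(x) q(y), where q is the quasi-periodic quadratic with q' ~ l. The
   projector rescales this vector so as to preserve the mean of u, and l, q agree
   with the plane wave up to O(h^2). *)

Set Implicit Arguments.
Unset Strict Implicit.
Unset Printing Implicit Defensive.

Local Open Scope ring_scope.

(** * Energy argument for the stationary equations *)

Section Energy.
Local Open Scope sesquilinear_scope.

Variables (C : numClosedFieldType).

Lemma trmxC_mul m n p (A : 'M[C]_(m, n)) (B : 'M[C]_(n, p)) :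
  (A *m B) ^t* = B ^t* *m A ^t*.
Proof. by rewrite trmx_mul map_mxM. Qed.

Lemma trace_trmxC n (A : 'M[C]_n) : \tr (A ^t*) = (\tr A)^*.
Proof. by rewrite trace_map_mx mxtrace_tr. Qed.

Lemma mxtrace_gram m n (A : 'M[C]_(m, n)) :
  \tr (A ^t* *m A) = \sum_j \sum_i `|A i j| ^+ 2.
Proof.
apply: eq_bigr => j _; rewrite mxE; apply: eq_bigr => i _.
by rewrite !mxE normCK mulrC.
Qed.

Lemma mxtrace_gram_ge0 m n (A : 'M[C]_(m, n)) : 0 <= \tr (A ^t* *m A).
Proof.
by rewrite mxtrace_gram; do 2! apply: sumr_ge0 => ? _; rewrite exprn_ge0.
Qed.

Lemma mxtrace_gram_eq0 m n (A : 'M[C]_(m, n)) :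
  \tr (A ^t* *m A) = 0 -> A = 0.
Proof.
rewrite mxtrace_gram => /psumr_eq0P H; apply/matrixP => i j; rewrite mxE.
have /psumr_eq0P H2 : \sum_i `|A i j| ^+ 2 = 0.
  by apply: H => // k _; apply: sumr_ge0 => ? _; rewrite exprn_ge0.
apply/eqP; rewrite -normr_eq0 -sqrf_eq0.
by apply/eqP/H2 => // k _; rewrite exprn_ge0.
Qed.

Variables (n : nat) (X Y : 'M[C]_n) (wx wy : 'cV[C]_n).
Hypotheses (Xskew : X ^t* = - X) (Yskew : Y ^t* = - Y).

(* A component of the state is the matrix of its coefficients on b_k(x) b_l(y):
   operators in x act on the left, those in y act on the right, transposed. All
   operators carry a factor 2h. *)
Definition dissip (A : 'M[C]_n) : 'M[C]_n :=
  wx *m wx ^t* *m A + A *m (wy *m wy ^t*)^T.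

(** For the jump vectors introduced below, $w^*$ takes the value at the right end of a cell minus
    the value at the left end of its neighbour. Both equations together say that the piecewise
    polynomial has no jump across any interface. *)
Definition continuousDG (A : 'M[C]_n) : Prop :=
  wx ^t* *m A = 0 /\ A *m (wy ^t*)^T = 0.

(** Each dissipative term is built on some $ww^*$ and so contributes a Gram trace; in the y
    direction, cyclicity of the trace brings the right-hand factor to the front. *)
Lemma dissip_energy A : \tr (A ^t* *m dissip A) =
  \tr ((wx ^t* *m A) ^t* *m (wx ^t* *m A)) +
  \tr ((A *m (wy ^t*)^T) ^t* *m (A *m (wy ^t*)^T)).
Proof.
rewrite mulmxDr linearD /=; congr (_ + _).
  by rewrite trmxC_mul trmxCK !mulmxA.
rewrite trmx_mul !mulmxA mxtrace_mulC !mulmxA trmxC_mul trmxK.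
by congr (\tr (_ *m _ *m _ *m _)); rewrite map_mxCK.
Qed.

Lemma dissip_energy_ge0 A : 0 <= \tr (A ^t* *m dissip A).
Proof. by rewrite dissip_energy addr_ge0 // mxtrace_gram_ge0. Qed.

Lemma dissip_energy_eq0 A : \tr (A ^t* *m dissip A) = 0 -> continuousDG A.
Proof.
move/eqP; rewrite dissip_energy paddr_eq0 ?mxtrace_gram_ge0 //.
by case/andP=> /eqP/mxtrace_gram_eq0 ? /eqP/mxtrace_gram_eq0 ?.
Qed.

Lemma dissip_continuous A : continuousDG A -> dissip A = 0.
Proof.
by case=> h1 h2; rewrite /dissip -mulmxA h1 mulmx0 trmx_mul mulmxA h2 mul0mx addr0.
Qed.

(** Pair the three equations with [U], [V], [P] and add. Skewness of [X] and [Y] makes the coupling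
    terms cancel, which leaves a vanishing sum of three nonnegative dissipations. *)
Lemma stationary_continuous U V P :
  dissip U + X *m P = 0 -> dissip V + P *m Y^T = 0 ->
  dissip P + X *m U + V *m Y^T = 0 ->
  [/\ continuousDG U, continuousDG V & continuousDG P].
Proof.
move=> eU eV eP.
pose e A := \tr (A ^t* *m dissip A).
pose z := \tr (U ^t* *m X *m P); pose z' := \tr (V ^t* *m P *m Y^T).
have tr0 (A B : 'M[C]_n) : B = 0 -> \tr (A ^t* *m B) = 0.
  by move=> ->; rewrite mulmx0 mxtrace0.
have EU : e U + z = 0 by rewrite -(tr0 U _ eU) mulmxDr linearD /= mulmxA.
have EV : e V + z' = 0 by rewrite -(tr0 V _ eV) mulmxDr linearD /= mulmxA.
have EP : e P - z^* - z'^* = 0.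
  rewrite -(tr0 P _ eP) mulmxDr linearD mulmxDr linearD /=; congr (_ + _ + _).
    by rewrite /z -trace_trmxC !trmxC_mul trmxCK Xskew mulNmx mulmxN raddfN opprK.
  rewrite /z' -trace_trmxC !trmxC_mul trmxCK.
  have -> : (Y^T) ^t* = - Y^T by rewrite -map_trmx Yskew raddfN.
  by rewrite mulNmx raddfN opprK /= mxtrace_mulC -mulmxA.
(* The couplings enter the third equation conjugated. The dissipations are real, so conjugating the
   first two equations makes the couplings match. *)
have eJ A : (e A)^* = e A by apply/CrealP; rewrite ger0_real ?dissip_energy_ge0.
have EU' : e U + z^* = 0 by rewrite -eJ -rmorphD EU rmorph0.
have EV' : e V + z'^* = 0 by rewrite -eJ -rmorphD EV rmorph0.
have : e U + e V + e P == 0.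
  have -> : e U + e V + e P = e P - z^* - z'^* + (e U + z^*) + (e V + z'^*) by ring.
  by rewrite EP EU' EV' !addr0.
rewrite !paddr_eq0 ?addr_ge0 ?dissip_energy_ge0 //.
by case/andP=> /andP[/eqP ? /eqP ?] /eqP ?; split; apply: dissip_energy_eq0.
Qed.
End Energy.

(** * Central difference operators and summation by parts *)

Section SummationByParts.
Local Open Scope sesquilinear_scope.

Variables (C : numClosedFieldType) (n : nat) (G : 'M[C]_n) (bR bL : 'cV[C]_n).
Hypotheses (GJ : G ^ Num.conj = G) (bRJ : bR ^ Num.conj = bR) (bLJ : bL ^ Num.conj = bL).
(** Integration by parts on one cell, for the stiffness matrix and the end-point values of the
    basis. *)
Hypothesis sbp : G + G^T = bR *m bR^T - bL *m bL^T.

Definition jumpVec (t : C) : 'cV[C]_n := bR - t^-1 *: bL.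

(** Coefficient of the Jacobian in $2h\,\mathcal E$ in one direction: averaged flux minus volume
    term. *)
Definition centralMx (t : C) : 'M[C]_n :=
  jumpVec t *m (bR + t *: bL)^T - 2 *: G.

Lemma unit_conjV (t : C) : t * t^* = 1 -> (t^-1)^* = t.
Proof.
move=> tJ; have t0 : t != 0.
  by apply: contra_eq_neq tJ => ->; rewrite mul0r eq_sym oner_neq0.
by rewrite fmorphV /= -[t^*](mulKf t0) tJ mulr1 invrK.
Qed.

Lemma jumpVec_trmxC t : t * t^* = 1 -> jumpVec t ^t* = bR^T - t *: bL^T.
Proof.
move=> tJ; rewrite /jumpVec linearB linearZ /= map_mxB map_mxZ -!map_trmx.
by rewrite bRJ bLJ /= unit_conjV.
Qed.

(** Strong form of the operator: [sbp] moves the derivative onto the solution, and the interface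
    terms collect into a multiple of the jump. Without jumps only the exact derivative $2G^T$ is
    left. *)
Lemma centralMx_split t : t * t^* = 1 ->
  centralMx t = 2 *: G^T - (bR + t^-1 *: bL) *m jumpVec t ^t*.
Proof.
move=> tJ; have t0 : t != 0.
  by apply: contra_eq_neq tJ => ->; rewrite mul0r eq_sym oner_neq0.
rewrite /centralMx; set A := _ *m _; set B := _ *m _.
suff E : A + B = 2 *: G + 2 *: G^T.
  by apply: (addIr B); rewrite subrK addrAC E addrAC subrr add0r.
rewrite -scalerDr sbp /A /B jumpVec_trmxC // /jumpVec.
have -> : (bR + t *: bL)^T = bR^T + t *: bL^T by rewrite linearD linearZ.
rewrite !(mulmxDl, mulmxDr, mulmxN, mulNmx).
rewrite -!scalemxAl -!scalemxAr !scalerA mulVf // scale1r.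
set a := bR *m _; set b := bR *m _; set c := bL *m _; set d := bL *m _.
apply/matrixP => i j; rewrite !mxE; ring.
Qed.

(** The conjugate transpose of the strong form is the negative of the weak form. *)
Lemma centralMx_skew t : t * t^* = 1 -> centralMx t ^t* = - centralMx t.
Proof.
move=> tJ; rewrite {1}centralMx_split // /centralMx linearB linearZ /= trmxK.
rewrite map_mxB map_mxZ GJ trmxC_mul trmxCK /= conjC_nat opprB.
have -> : (bR + t^-1 *: bL) ^t* = (bR + t *: bL)^T; last by [].
rewrite !linearD !linearZ /= map_mxD map_mxZ -!map_trmx bRJ bLJ /=.
by rewrite unit_conjV.
Qed.

(** The energy argument removes the jumps and with them the dissipation; what is left of the scheme
    is $p_x=0$, $p_y=0$ and $u_x+v_y=0$ inside each cell. *)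
Lemma stationaryP (tx ty : C) (U V P : 'M[C]_n) :
  tx * tx^* = 1 -> ty * ty^* = 1 ->
  let X := centralMx tx in let Y := centralMx ty in
  let D := dissip (jumpVec tx) (jumpVec ty) in
  let W := continuousDG (jumpVec tx) (jumpVec ty) in
  [/\ D U + X *m P = 0, D V + P *m Y^T = 0 & D P + X *m U + V *m Y^T = 0] <->
  [/\ W U, W V & W P] /\ [/\ G^T *m P = 0, P *m G = 0 & G^T *m U + V *m G = 0].
Proof.
move=> txJ tyJ X Y D W.
have XE A : W A -> X *m A = 2 *: (G^T *m A).
  case=> h _; rewrite /X centralMx_split // mulmxBl -mulmxA h mulmx0 subr0.
  by rewrite scalemxAl.
have YE A : W A -> A *m Y^T = 2 *: (A *m G).
  case=> _ h; rewrite /Y centralMx_split // linearB linearZ /= trmxK trmx_mul.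
  by rewrite mulmxBr mulmxA h mul0mx subr0 scalemxAr.
have two0 (A : 'M[C]_n) : 2 *: A = 0 -> A = 0.
  by move/eqP; rewrite scaler_eq0 pnatr_eq0 => /eqP.
split=> [[eU eV eP]|[[hU hV hP] [eU eV eP]]].
  have [hU hV hP] := stationary_continuous (centralMx_skew txJ)
    (centralMx_skew tyJ) eU eV eP.
  split=> //; move: eU eV eP; rewrite /D !dissip_continuous // !add0r.
  by rewrite !XE // !YE // -scalerDr => /two0 ? /two0 ? /two0 ?.
by rewrite /D !dissip_continuous // !add0r !XE // !YE // -scalerDr eU eV eP scaler0.
Qed.
End SummationByParts.

(** * The three-element index set *)

Local Notation o0 := (@Ordinal 3 0 isT).
Local Notation o1 := (@Ordinal 3 1 isT).
Local Notation o2 := (@Ordinal 3 2 isT).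

(** The three cases are literal ordinals, so entries given by lists reduce by computation. *)
Lemma ord3P (Q : 'I_3 -> Prop) : Q o0 -> Q o1 -> Q o2 -> forall i, Q i.
Proof.
move=> Q0 Q1 Q2 [[|[|[|//]]] lti].
- by rewrite (_ : Ordinal lti = o0) //; apply: val_inj.
- by rewrite (_ : Ordinal lti = o1) //; apply: val_inj.
- by rewrite (_ : Ordinal lti = o2) //; apply: val_inj.
Qed.

Lemma sum3E (V : nmodType) (F : 'I_3 -> V) : \sum_i F i = F o0 + F o1 + F o2.
Proof.
rewrite !big_ord_recl big_ord0 addr0 addrA.
by congr (_ + F _ + F _); [congr F | ..]; apply: val_inj.
Qed.

(** * Stationary states for degree two *)

Section Degree2.
Local Open Scope sesquilinear_scope.

Variables (C : numClosedFieldType) (r3 r5 : C).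
Hypotheses (r3E : r3 ^+ 2 = 3) (r5E : r5 ^+ 2 = 5).
Hypotheses (r3J : r3^* = r3) (r5J : r5^* = r5).

(** End-point values of $b_0,b_1,b_2$. The roots of 3 and 5 are kept abstract as [r3] and [r5],
    known only through their squares and their reality. *)
Definition faceR : 'cV[C]_3 := \col_i [:: 1; r3; r5]`_i.
Definition faceL : 'cV[C]_3 := \col_i [:: 1; - r3; r5]`_i.
(** The two nonzero entries come from $b_1'=2\sqrt3\,b_0$ and $b_2'=2\sqrt{15}\,b_1$. *)
Definition stiffMx : 'M[C]_3 :=
  \matrix_(i, j) (nth [::] [:: [:: 0; 0; 0];
                               [:: 2 * r3; 0; 0];
                               [:: 0; 2 * (r3 * r5); 0]] i)`_j.

Lemma stiffMxJ : stiffMx ^ Num.conj = stiffMx.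
Proof.
apply/matrixP; apply: ord3P; apply: ord3P; rewrite !mxE /= ?rmorph0 //.
all: by rewrite !rmorphM /= ?r3J ?r5J conjC_nat.
Qed.

Lemma faceRJ : faceR ^ Num.conj = faceR.
Proof. by apply/matrixP; apply: ord3P => j; rewrite !mxE /= ?rmorph1 ?r3J ?r5J. Qed.

Lemma faceLJ : faceL ^ Num.conj = faceL.
Proof.
by apply/matrixP; apply: ord3P => j; rewrite !mxE //= ?rmorph1 // rmorphN /= r3J.
Qed.

Lemma stiffMx_sbp : stiffMx + stiffMx^T = faceR *m faceR^T - faceL *m faceL^T.
Proof.
by apply/matrixP; apply: ord3P; apply: ord3P; rewrite !mxE !big_ord1 !mxE /=; ring.
Qed.

Let r3n0 : r3 != 0.
Proof. by rewrite -sqrf_eq0 r3E pnatr_eq0. Qed.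
Let r5n0 : r5 != 0.
Proof. by rewrite -sqrf_eq0 r5E pnatr_eq0. Qed.

(* Half the phase shift across a cell has cosine [c] and sine [s]. *)
Definition transl (c s : C) : C := (c + 'i * s) ^+ 2.

(* f = f0 b_0 + f1 b_1 + f2 b_2 satisfies f(1/2) = transl c s * f(-1/2). *)
Definition matched (c s f0 f1 f2 : C) : Prop :=
  r3 * c * f1 = 'i * s * (f0 + r5 * f2).

Section HalfAngle.
Variables (c s : C).
Hypotheses (cJ : c^* = c) (sJ : s^* = s) (cs1 : c ^+ 2 + s ^+ 2 = 1).

Lemma half_phase_conj : (c + 'i * s) * (c - 'i * s) = 1.
Proof.
have i2 := sqrCi C; rewrite -cs1.
by rewrite [LHS](_ : _ = c ^+ 2 - 'i ^+ 2 * s ^+ 2); [rewrite i2; ring | ring].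
Qed.

Lemma translJ : transl c s * (transl c s)^* = 1.
Proof.
rewrite /transl rmorphXn rmorphD rmorphM /= cJ sJ conjCi mulNr -exprMn.
by rewrite half_phase_conj expr1n.
Qed.

(** With $e=c+is$, where $e(c-is)=1$, the jump $f(1/2)-e^2f(-1/2)$ equals $e$ times
    $(c-is)f(1/2)-(c+is)f(-1/2)$. In the latter, $c$ multiplies the odd part of $f$ and $s$ the even
    part. *)
Lemma matchedP f0 f1 f2 :
  matched c s f0 f1 f2 <->
  (1 - transl c s) * f0 + (r3 + transl c s * r3) * f1
    + (r5 - transl c s * r5) * f2 = 0.
Proof.
have h := half_phase_conj; have n0 : c + 'i * s != 0.
  by apply: contra_eq_neq h => ->; rewrite mul0r eq_sym oner_neq0.
have -> : (1 - transl c s) * f0 + (r3 + transl c s * r3) * f1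
    + (r5 - transl c s * r5) * f2 =
    (c + 'i * s) * 2 * (r3 * c * f1 - 'i * s * (f0 + r5 * f2)).
  rewrite /transl; set e := c + 'i * s in h *.
  have -> : (1 - e ^+ 2) * f0 + (r3 + e ^+ 2 * r3) * f1 +
    (r5 - e ^+ 2 * r5) * f2 = e * (c - 'i * s) * (f0 + r3 * f1 + r5 * f2)
    - e * e * (f0 - r3 * f1 + r5 * f2) by rewrite h; ring.
  by rewrite /e; ring.
split=> [->|/eqP]; first by rewrite subrr mulr0.
by rewrite !mulf_eq0 (negPf n0) pnatr_eq0 /= subr_eq0 => /eqP.
Qed.
End HalfAngle.

Variables (cx sx cy sy : C).
Hypotheses (cxJ : cx^* = cx) (sxJ : sx^* = sx) (csx1 : cx ^+ 2 + sx ^+ 2 = 1).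
Hypotheses (cyJ : cy^* = cy) (syJ : sy^* = sy) (csy1 : cy ^+ 2 + sy ^+ 2 = 1).

Let tx := transl cx sx.
Let ty := transl cy sy.

Lemma continuous_matchedP (A : 'M[C]_3) :
  continuousDG (jumpVec faceR faceL tx) (jumpVec faceR faceL ty) A <->
  (forall j, matched cx sx (A o0 j) (A o1 j) (A o2 j)) /\
  (forall i, matched cy sy (A i o0) (A i o1) (A i o2)).
Proof.
rewrite /continuousDG !(jumpVec_trmxC faceRJ faceLJ) ?translJ //.
split=> [[/matrixP hx /matrixP hy]|[hx hy]].
  split=> k.
    apply/(matchedP csx1); have := hx 0 k.
    by rewrite !mxE sum3E !mxE /= !mulr1 mulrN opprK.
  apply/(matchedP csy1); have := hy k 0.
  rewrite !mxE sum3E !mxE /= !mulr1 mulrN opprK => <-.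
  by rewrite ![A k _ * _]mulrC.
split; apply/matrixP => i j.
  have /(matchedP csx1) := hx j; rewrite !mxE sum3E !mxE /= !mulr1 mulrN opprK.
  by [].
have /(matchedP csy1) := hy i; rewrite !mxE sum3E !mxE /= !mulr1 mulrN opprK.
by rewrite ![A i _ * _]mulrC.
Qed.

Definition stationary (U V P : 'M[C]_3) : Prop :=
  let X := centralMx stiffMx faceR faceL tx in
  let Y := centralMx stiffMx faceR faceL ty in
  let D := dissip (jumpVec faceR faceL tx) (jumpVec faceR faceL ty) in
  [/\ D U + X *m P = 0, D V + P *m Y^T = 0 & D P + X *m U + V *m Y^T = 0].

Let W := continuousDG (jumpVec faceR faceL tx) (jumpVec faceR faceL ty).

Lemma stationary2P (U V P : 'M[C]_3) :
  stationary U V P <->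
  [/\ W U, W V & W P] /\
  [/\ stiffMx^T *m P = 0, P *m stiffMx = 0 & stiffMx^T *m U + V *m stiffMx = 0].
Proof.
exact: (stationaryP stiffMxJ faceRJ faceLJ stiffMx_sbp U V P (translJ cxJ sxJ csx1)
  (translJ cyJ syJ csy1)).
Qed.

(* Coefficients of l = c + 2isx and of q = c^2 + 2iscx - 2s^2 (x^2 - 1/4), for
   which q' = 2is l. *)
Definition linProfile (c s : C) : 'cV[C]_3 :=
  \col_i [:: c; 'i * s / r3; 0]`_i.
Definition quadProfile (c s : C) : 'cV[C]_3 :=
  \col_i [:: c ^+ 2 + s ^+ 2 / 3; 'i * s * c / r3; - s ^+ 2 / (3 * r5)]`_i.

(** Since $q'=2isl$, the terms $u_x$ and $v_y$ are $\mp2is_xs_y\,l(x)l(y)$ and cancel. *)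
Definition statU : 'M[C]_3 :=
  \matrix_(i, j) (- sy * (quadProfile cx sx i 0 * linProfile cy sy j 0)).
Definition statV : 'M[C]_3 :=
  \matrix_(i, j) (sx * (linProfile cx sx i 0 * quadProfile cy sy j 0)).

Lemma linProfile_matched c s (l := linProfile c s) :
  matched c s (l o0 0) (l o1 0) (l o2 0).
Proof. by rewrite /matched /l !mxE /=; field; rewrite r3n0. Qed.

Lemma quadProfile_matched c s (q := quadProfile c s) :
  matched c s (q o0 0) (q o1 0) (q o2 0).
Proof. by rewrite /matched /q !mxE /=; field; rewrite r3n0 r5n0. Qed.

Lemma matchedZ c s a f0 f1 f2 :
  matched c s f0 f1 f2 -> matched c s (a * f0) (a * f1) (a * f2).
Proof.
rewrite /matched => h.
by rewrite [LHS](_ : _ = a * (r3 * c * f1)); [rewrite h|]; ring.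
Qed.

Lemma stat_stationary : stationary statU statV 0.
Proof.
have sw (a b d : C) : a * (b * d) = a * d * b by ring.
have UE i j : statU i j = - sy * (quadProfile cx sx i 0 * linProfile cy sy j 0).
  by rewrite mxE.
have VE i j : statV i j = sx * (linProfile cx sx i 0 * quadProfile cy sy j 0).
  by rewrite mxE.
apply/stationary2P; split; split; rewrite ?mulmx0 ?mul0mx //.
- apply/continuous_matchedP; split=> k; rewrite ?UE ?VE.
    by rewrite !sw; apply/matchedZ/quadProfile_matched.
  by rewrite !mulrA; apply/matchedZ/linProfile_matched.
- apply/continuous_matchedP; split=> k; rewrite ?UE ?VE.
    by rewrite !sw; apply/matchedZ/linProfile_matched.
  by rewrite !mulrA; apply/matchedZ/quadProfile_matched.
- by apply/continuous_matchedP; split=> k; rewrite /matched !mxE; ring.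
(* [field] treats $i$ as an atom: two entries of the divergence are multiples of $i^2+1$, whose
   vanishing is supplied by hand. *)
have i2 (k : C) : k * ('i ^+ 2 + 1) = 0 by rewrite sqrCi addNr mulr0.
apply/matrixP; apply: ord3P; apply: ord3P; rewrite !mxE !sum3E !mxE /=.
all: rewrite -?r3E ?mulr0 ?mul0r ?addr0 ?add0r ?mulr0 ?mul0r //.
- by field; rewrite r3n0.
- rewrite -[RHS](i2 (- (2 * sx * cx * sy ^+ 2 / r3))).
  by field; rewrite r3n0 r5n0.
- rewrite -[RHS](i2 (2 * sx ^+ 2 * cy * sy / r3)).
  by field; rewrite r3n0 r5n0.
- by field; rewrite r3n0 r5n0.
Qed.

Lemma matched_const c s f0 : s != 0 -> matched c s f0 0 0 -> f0 = 0.
Proof.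
move=> s0 /esym /eqP.
by rewrite !mulr0 addr0 !mulf_eq0 (negPf s0) (negPf (neq0Ci C)) => /eqP.
Qed.

Lemma matched_linear c s f1 : c != 0 -> matched c s 0 f1 0 -> f1 = 0.
Proof.
move=> c0 /eqP.
by rewrite !mulr0 addr0 mulr0 !mulf_eq0 (negPf c0) (negPf r3n0) => /eqP.
Qed.

(** The system is solved entry by entry, combining the divergence equation with the matching
    conditions. Nonzero sines exclude constants among the matched functions, nonzero cosines exclude
    odd linear ones. *)
Lemma stationary_unique U V P : cx != 0 -> cy != 0 -> sx != 0 -> sy != 0 ->
  stationary U V P -> U o0 o0 = 0 -> [/\ U = 0, V = 0 & P = 0].
Proof.
move=> cx0 cy0 sx0 sy0.
case/stationary2P => -[/continuous_matchedP[Ux Uy] /continuous_matchedP[Vx Vy]].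
move=> /continuous_matchedP[Px Py] [/matrixP PX _ /matrixP UV] U00.
have mul_r3 x : 2 * r3 * x = 0 -> x = 0.
  by move/eqP; rewrite !mulf_eq0 pnatr_eq0 (negPf r3n0) => /eqP.
have mul_r35 x : 2 * (r3 * r5) * x = 0 -> x = 0.
  by move/eqP; rewrite !mulf_eq0 pnatr_eq0 (negPf r3n0) (negPf r5n0) => /eqP.
have PE : P = 0.
  (* $p$ is constant in $x$, and a nonzero sine forbids a nonzero quasi-periodic constant. *)
  apply/matrixP => i j; rewrite [RHS]mxE; move: i.
  move: (PX o0 j) (PX o1 j) (Px j); rewrite !mxE !sum3E !mxE /=.
  rewrite !(mul0r, addr0, add0r) => /mul_r3 P1 /mul_r35 P2.
  by rewrite P1 P2 => /(matched_const sx0) P0; apply: ord3P.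
move: (UV o0 o0) (UV o0 o1) (UV o0 o2) (UV o1 o0) (UV o1 o1) (UV o1 o2)
  (UV o2 o0) (UV o2 o1).
rewrite !mxE !sum3E !mxE /= !(mul0r, mulr0, addr0, add0r).
(* As $u_x=-v_y$ has degree at most one in each variable, the entries of [U] that are nonconstant in
   $x$ and quadratic in $y$ vanish; likewise for [V] with the variables exchanged. *)
move=> E00 E01 /mul_r3 U12 E10 E11 /mul_r35 U22.
rewrite ![V _ _ * _]mulrC => /mul_r3 V21 /mul_r35 V22.
have U02 : U o0 o2 = 0.
  by have := Ux o2; rewrite U12 U22 => /(matched_const sx0).
have V20 : V o2 o0 = 0.
  by have := Vy o2; rewrite V21 V22 => /(matched_const sy0).
have U01 : U o0 o1 = 0.
  by have := Uy o0; rewrite U00 U02 => /(matched_linear cy0).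
have canc (a x y : C) : a != 0 -> a * x + a * y = 0 -> y = - x.
  move=> a0 /eqP; rewrite -mulrDr mulf_eq0 (negPf a0) addrC addr_eq0 /=.
  by move/eqP.
have n2 : 2 != 0 :> C by rewrite pnatr_eq0.
have n23 : 2 * r3 != 0 by rewrite mulf_neq0.
have n235 : 2 * (r3 * r5) != 0 by rewrite !mulf_neq0.
have V01 : V o0 o1 = - U o1 o0 by apply: canc n23 _; rewrite [X in _ + X]mulrC.
have V12 : V o1 o2 = - U o2 o1 by apply: canc n235 _; rewrite [X in _ + X]mulrC.
have V11 : V o1 o1 = - (r5 * U o2 o0).
  by apply: (canc _ _ _ n23); rewrite -E10; ring.
have V02 : r5 * V o0 o2 = - U o1 o1.
  by apply: (canc _ _ _ n23); rewrite -E01; ring.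
(* Continuity in $x$ of column 0 of [U] and of column 1 of [V] gives two relations between [U o1 o0]
   and [U o2 o0]. Eliminating the latter leaves the factor $3c_x^2+s_x^2=1+2c_x^2$, positive since
   $c_x$ is real. *)
have U10 : U o1 o0 = 0.
  have := Ux o0; have := Vx o1.
  rewrite /matched U00 V01 V11 V21 mulr0 addr0 add0r => e1 e2.
  have : (1 + 2 * cx ^+ 2) * U o1 o0 = 0.
    have -> : (1 + 2 * cx ^+ 2) * U o1 o0 =
      (r3 ^+ 2 * cx ^+ 2 - 'i ^+ 2 * sx ^+ 2) * U o1 o0.
      by rewrite r3E sqrCi -[X in X + 2 * _]csx1; ring.
    rewrite [LHS](_ : _ = r3 * cx * (r3 * cx * U o1 o0)
      + 'i * sx * ('i * sx * - U o1 o0)); last by ring.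
    by rewrite -e1 e2; ring.
  move/eqP; rewrite mulf_eq0 => /predU1P[h|/eqP //]; exfalso.
  suff : 0 < 1 + 2 * cx ^+ 2 by rewrite h ltxx.
  rewrite ltr_pwDl // mulr_ge0 // real_exprn_even_ge0 //.
  by apply/CrealP.
move: V01 V11; rewrite U10 oppr0 => V01.
have U11 : U o1 o1 = 0.
  by have := Uy o1; rewrite U10 U12 => /(matched_linear cy0).
move: V02; rewrite U11 oppr0 => /eqP; rewrite mulf_eq0 (negPf r5n0) => /eqP V02.
have V11 : V o1 o1 = 0.
  by have := Vx o1; rewrite V01 V21 => /(matched_linear cx0).
rewrite V11 => /esym/eqP; rewrite oppr_eq0 mulf_eq0 (negPf r5n0) => /eqP U20.
have U21 : U o2 o1 = 0.
  by have := Uy o2; rewrite U20 U22 => /(matched_linear cy0).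
move: V12; rewrite U21 oppr0 => V12.
have V00 : V o0 o0 = 0.
  by have := Vy o0; rewrite V01 V02 => /(matched_const sy0).
have V10 : V o1 o0 = 0.
  by have := Vy o1; rewrite V11 V12 => /(matched_const sy0).
by split=> //; apply/matrixP; apply: ord3P; apply: ord3P; rewrite [RHS]mxE.
Qed.
End Degree2.

Local Open Scope classical_set_scope.
Local Open Scope ring_scope.
Local Open Scope complex_scope.

(** * Integrals of polynomials and Taylor bounds for sine and cosine *)

Section RealIntegrals.
Variable R : realType.
Implicit Types (a b d x : R) (f g : R -> R).

Lemma continuous_integrable a b f : continuous f ->
  (@lebesgue_measure R).-integrable `[a, b] (EFin \o f).
Proof.
move=> cf; apply: continuous_compact_integrable; first exact: segment_compact.
exact: continuous_subspaceT.
Qed.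

Lemma Rintegral_deriv (p : {poly R}) a b : a < b ->
  \int[lebesgue_measure]_(x in `[a, b]) (p^`()).[x] = p.[b] - p.[a].
Proof.
move=> ab; rewrite /Rintegral (@continuous_FTC2 _ _ (horner p)) //.
- exact/continuous_subspaceT/continuous_horner.
- split=> [x _||]; first exact: derivable_horner.
  + by apply: cvg_at_right_filter; exact: continuous_horner.
  + by apply: cvg_at_left_filter; exact: continuous_horner.
- by move=> x _; rewrite -derivE.
Qed.

(** The exact integrals computed below are of polynomials of degree at most four over symmetric
    intervals, where odd powers drop out. *)
Lemma Rintegral_quartic c0 c1 c2 c3 c4 d f : 0 < d ->
  (forall x, f x = c0 + c1 * x + c2 * x ^+ 2 + c3 * x ^+ 3 + c4 * x ^+ 4) ->
  \int[lebesgue_measure]_(x in `[- d, d]) f x =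
  2 * (c0 * d + c2 * d ^+ 3 / 3 + c4 * d ^+ 5 / 5).
Proof.
move=> d0 fE.
pose p : {poly R} := c0 *: 'X + (c1 / 2) *: 'X^2 + (c2 / 3) *: 'X^3
  + (c3 / 4) *: 'X^4 + (c4 / 5) *: 'X^5.
have pE x : p.[x] = c0 * x + c1 / 2 * x ^+ 2 + c2 / 3 * x ^+ 3
  + c3 / 4 * x ^+ 4 + c4 / 5 * x ^+ 5 by rewrite /p !hornerE.
transitivity (p.[d] - p.[- d]); last by rewrite !pE; field.
rewrite -Rintegral_deriv; last by lra.
apply: eq_Rintegral => x _.
rewrite fE /p !derivD !derivZ !derivXn derivX !hornerE /= ?hornerMn ?hornerE.
by field.
Qed.

Lemma Rintegral_dist a b (e : R) f g : a < b -> continuous f -> continuous g ->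
  (forall x, a <= x <= b -> `|f x - g x| <= e) ->
  `|\int[lebesgue_measure]_(x in `[a, b]) f x -
    \int[lebesgue_measure]_(x in `[a, b]) g x| <= e * (b - a).
Proof.
move=> ab cf cg fg.
have cfg : continuous (f \- g) by move=> x; apply: cvgB; [exact: cf|exact: cg].
rewrite -RintegralB //; try exact: continuous_integrable.
have := le_normr_Rintegral _ (@continuous_integrable a b _ cfg).
move=> /(_ _)/le_trans; apply=> //.
have -> : e * (b - a) = \int[lebesgue_measure]_(x in `[a, b]) (cst e x).
  by rewrite Rintegral_cst //= lebesgue_measure_itv /= lte_fin ab.
apply: le_Rintegral => //; try exact: continuous_integrable.
- apply: (@continuous_integrable _ _ (fun x => `|(f \- g) x|)) => x.
  by apply: continuous_comp; [exact: cfg|exact: norm_continuous].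
- by apply: continuous_integrable => x; exact: cvg_cst.
Qed.

(** Applied in turn to $\sin$, $\cos$ and $\sin x-x$, each bound feeding the next, this gives the
    Taylor remainders below. *)
Lemma mvt0 f (df : R -> R) x : (forall y : R, is_derive y (1 : R) f (df y)) ->
  exists2 c, `|c| <= `|x| & f x - f 0 = df c * x.
Proof.
move=> fd; have cf : continuous f.
  by move=> y; apply/differentiable_continuous/derivable1_diffP.
have [x0|x0] := leP 0 x.
  have [c /[!in_itv]/= /andP[c0 cx] E] := MVT_segment x0
    (fun y _ => fd y) (continuous_subspaceT cf).
  exists c; first by rewrite !ger0_norm.
  by rewrite E subr0.
have [c /[!in_itv]/= /andP[c0 cx] E] := MVT_segment (ltW x0)
  (fun y _ => fd y) (continuous_subspaceT cf).
exists c; first by rewrite !ler0_norm ?lerN2 // ltW.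
by apply: oppr_inj; rewrite opprB E sub0r mulrN.
Qed.

Lemma sin_dist0 x : `|sin x| <= `|x|.
Proof.
have [c _] := mvt0 x (@is_derive_sin R); rewrite sin0 subr0 => ->.
by rewrite normrM ler_piMl // cos_max.
Qed.

Lemma cos_dist1 x : `|cos x - 1| <= `|x| ^+ 2.
Proof.
have [c cx] := mvt0 x (@is_derive_cos R); rewrite cos0 => ->.
rewrite normrM normrN expr2 ler_wpM2r //; exact: le_trans (sin_dist0 c) cx.
Qed.

Lemma sin_dist_id x : `|sin x - x| <= `|x| ^+ 3.
Proof.
have fd (y : R) : is_derive y (1 : R) (sin \- id : R -> R) (cos y - 1) by apply: is_deriveB.
have [c cx] := mvt0 x fd; rewrite /= sin0 !subr0 => ->.
rewrite normrM exprSr ler_wpM2r //.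
by apply: le_trans (cos_dist1 c) _; rewrite lerXn2r ?nnegrE.
Qed.
End RealIntegrals.

(** * The orthonormal basis of degree two *)

Section Basis2.
Variable R : realType.
Notation b := (@basis2 R).
Notation r3 := (Num.sqrt 3 : R).
Notation r5 := (Num.sqrt 5 : R).

Let r3E : r3 ^+ 2 = 3. Proof. by rewrite sqr_sqrtr. Qed.
Let r5E : r5 ^+ 2 = 5. Proof. by rewrite sqr_sqrtr. Qed.

Lemma basis2_0 x : (b o0).[x] = 1. Proof. by rewrite /basis2 /= hornerE. Qed.
Lemma basis2_1 x : (b o1).[x] = 2 * r3 * x.
Proof. by rewrite /basis2 /= !hornerE. Qed.
Lemma basis2_2 x : (b o2).[x] = r5 / 2 * (12 * x ^+ 2 - 1).
Proof. by rewrite /basis2 /= !hornerE. Qed.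
Lemma dbasis2_0 x : (b o0)^`().[x] = 0.
Proof. by rewrite /basis2 /= derivC hornerE. Qed.
Lemma dbasis2_1 x : (b o1)^`().[x] = 2 * r3.
Proof. by rewrite /basis2 /= derivZ derivX !hornerE. Qed.
Lemma dbasis2_2 x : (b o2)^`().[x] = 12 * r5 * x.
Proof.
rewrite /basis2 /= derivZ derivB derivZ derivXn derivC !hornerE /=.
by rewrite ?hornerMn ?hornerE; field.
Qed.

Definition basis2E := (basis2_0, basis2_1, basis2_2, dbasis2_0, dbasis2_1, dbasis2_2).

Let half0 : 0 < 2^-1 :> R. Proof. by rewrite invr_gt0. Qed.

(** In each case the numbers handed to [Rintegral_quartic] are the coefficients of $b_kb_a$ and the
    half-width of the cell. *)
Lemma massM_basis2 k a : massM b k a = (k == a)%:R.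
Proof.
rewrite /massM; move: k a; apply: ord3P; apply: ord3P.
- rewrite (@Rintegral_quartic R 1 0 0 0 0 2^-1) => [||x] //.
    by rewrite /=; field.
  by rewrite !basis2E; ring.
- rewrite (@Rintegral_quartic R 0 (2 * r3) 0 0 0 2^-1) => [||x] //.
    by rewrite /=; field.
  by rewrite !basis2E; ring.
- rewrite (@Rintegral_quartic R (- r5 / 2) 0 (6 * r5) 0 0 2^-1) => [||x] //.
    by rewrite /=; field.
  by rewrite !basis2E; field.
- rewrite (@Rintegral_quartic R 0 (2 * r3) 0 0 0 2^-1) => [||x] //.
    by rewrite /=; field.
  by rewrite !basis2E; ring.
- rewrite (@Rintegral_quartic R 0 0 12 0 0 2^-1) => [||x] //.
    by rewrite /=; field.
  by rewrite !basis2E (_ : 12 = 4 * r3 ^+ 2); [ring | rewrite r3E; ring].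
- rewrite (@Rintegral_quartic R 0 (- r3 * r5) 0 (12 * r3 * r5) 0 2^-1) => [||x] //.
    by rewrite /=; field.
  by rewrite !basis2E; field.
- rewrite (@Rintegral_quartic R (- r5 / 2) 0 (6 * r5) 0 0 2^-1) => [||x] //.
    by rewrite /=; field.
  by rewrite !basis2E; field.
- rewrite (@Rintegral_quartic R 0 (- r3 * r5) 0 (12 * r3 * r5) 0 2^-1) => [||x] //.
    by rewrite /=; field.
  by rewrite !basis2E; field.
- rewrite (@Rintegral_quartic R (r5 ^+ 2 / 4) 0 (- 6 * r5 ^+ 2) 0 (36 * r5 ^+ 2) 2^-1) => [||x] //.
    by rewrite r5E /=; field.
  by rewrite !basis2E; field.
Qed.

Lemma gradG_basis2 k a : (gradG b k a)%:C = stiffMx (r3%:C) (r5%:C) k a.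
Proof.
have two : (2 : R[i]) = (2 : R)%:C by rewrite rmorph_nat.
rewrite /gradG; move: k a; apply: ord3P; apply: ord3P; rewrite mxE /=.
- rewrite (@Rintegral_quartic R 0 0 0 0 0 2^-1) => [||x] //.
    by congr (_ %:C); ring.
  by rewrite !basis2E; ring.
- rewrite (@Rintegral_quartic R 0 0 0 0 0 2^-1) => [||x] //.
    by congr (_ %:C); ring.
  by rewrite !basis2E; ring.
- rewrite (@Rintegral_quartic R 0 0 0 0 0 2^-1) => [||x] //.
    by congr (_ %:C); ring.
  by rewrite !basis2E; ring.
- rewrite (@Rintegral_quartic R (2 * r3) 0 0 0 0 2^-1) => [||x] //.
    by rewrite two -rmorphM; congr (_ %:C); field.
  by rewrite !basis2E; ring.
- rewrite (@Rintegral_quartic R 0 (2 * r3 * (2 * r3)) 0 0 0 2^-1) => [||x] //.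
    by congr (_ %:C); ring.
  by rewrite !basis2E; ring.
- rewrite (@Rintegral_quartic R (- r3 * r5) 0 (12 * r3 * r5) 0 0 2^-1) => [||x] //.
    by congr (_ %:C); field.
  by rewrite !basis2E; field.
- rewrite (@Rintegral_quartic R 0 (12 * r5) 0 0 0 2^-1) => [||x] //.
    by congr (_ %:C); ring.
  by rewrite !basis2E; ring.
- rewrite (@Rintegral_quartic R 0 0 (24 * r5 * r3) 0 0 2^-1) => [||x] //.
    rewrite two -!rmorphM; congr (_ %:C).
    by rewrite /=; field.
  by rewrite !basis2E; ring.
- rewrite (@Rintegral_quartic R 0 (- 6 * r5 ^+ 2) 0 (72 * r5 ^+ 2) 0 2^-1) => [||x] //.
    by congr (_ %:C); ring.
  by rewrite !basis2E; field.
Qed.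

Lemma bR_basis2 k : bR b k = faceR (r3%:C) (r5%:C) k 0.
Proof.
rewrite /bR; move: k; apply: ord3P; rewrite basis2E mxE //=.
  by congr (_ %:C); field.
by congr (_ %:C); field.
Qed.

Lemma bL_basis2 k : bL b k = faceL (r3%:C) (r5%:C) k 0.
Proof.
rewrite /bL; move: k; apply: ord3P; rewrite basis2E mxE //=.
  by rewrite -rmorphN; congr (_ %:C); field.
by congr (_ %:C); field.
Qed.

Lemma basis2_bounded k : exists2 M, 0 < M &
  forall x, `|x| <= 1 / 2 -> `|(b k).[x]| <= M.
Proof.
have r30 : 0 <= r3 := sqrtr_ge0 _; have r50 : 0 <= r5 := sqrtr_ge0 _.
(* On the cell $|b_1|\le\sqrt3$ and $|b_2|\le\sqrt5$, so one constant serves all three. *)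
exists (1 + r3 + r5) => [|x]; first by lra.
rewrite ler_norml => /andP[x1 x2].
have y1 : 0 <= 1 / 4 - x ^+ 2 by nra.
have y0 : 0 <= x ^+ 2 by exact: sqr_ge0.
have p1 : 0 <= r3 * (x + 1 / 2) by apply: mulr_ge0 => //; lra.
have p2 : 0 <= r3 * (1 / 2 - x) by apply: mulr_ge0 => //; lra.
have p3 := mulr_ge0 r50 y0; have p4 := mulr_ge0 r50 y1.
by move: k; apply: ord3P; rewrite basis2E ler_norml; apply/andP; split; nra.
Qed.
End Basis2.

(** * Fourier moments of the mode *)

Section ModeIntegrals.
Variable R : realType.
Implicit Types (a c : R) (f g : R -> R[i]).

Definition ccontinuous f :=
  continuous (fun x => complex.Re (f x)) /\ continuous (fun x => complex.Im (f x)).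

(** [cintegral] is defined through real and imaginary parts, which a complex factor mixes;
    continuity supplies the integrability for splitting the sums. *)
Lemma cintegralZl a c f (z : R[i]) : ccontinuous f ->
  cintegral a c (fun x => z * f x) = z * cintegral a c f.
Proof.
case: z => zr zi [fr fi]; rewrite /cintegral.
have E1 : (fun x => complex.Re ((zr +i* zi) * f x)) =
    (fun x => zr * complex.Re (f x) - zi * complex.Im (f x)).
  by apply/funext => x; case: (f x).
have E2 : (fun x => complex.Im ((zr +i* zi) * f x)) =
    (fun x => zr * complex.Im (f x) + zi * complex.Re (f x)).
  by apply/funext => x; case: (f x).
have cZ (y : R) (h : R -> R) : continuous h -> continuous (fun x => y * h x).
  by move=> ch x; apply: cvgM; [exact: cvg_cst|exact: ch].
rewrite E1 E2 RintegralB ?RintegralD //; try by apply/continuous_integrable/cZ.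
rewrite !RintegralZl //; exact: continuous_integrable.
Qed.

Lemma ccontinuous_mode (p : {poly R}) d k :
  ccontinuous (fun x => (p.[x / d])%:C * expi (k * x)).
Proof.
have cl (y : R) : continuous (fun x : R => y * x).
  by move=> x; apply: cvgM; [exact: cvg_cst|exact: cvg_id].
have cp : continuous (fun x : R => p.[x / d]).
  move=> x; apply: (@continuous_comp R R R (fun x : R => x / d) (horner p)).
    by apply: cvgM; [exact: cvg_id|exact: cvg_cst].
  exact: continuous_horner.
split.
- have -> : (fun x => complex.Re (p.[x / d]%:C * expi (k * x))) =
    (fun x => p.[x / d] * cos (k * x)).
    by apply/funext => x; rewrite /= mul0r subr0.
  move=> x; apply: cvgM; first exact: cp.
  by apply: (@continuous_comp R R R ( *%R k) (@cos R)); [exact: cl|exact: continuous_cos].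
- have -> : (fun x => complex.Im (p.[x / d]%:C * expi (k * x))) =
    (fun x => p.[x / d] * sin (k * x)).
    by apply/funext => x; rewrite /= mul0r addr0.
  move=> x; apply: cvgM; first exact: cp.
  by apply: (@continuous_comp R R R ( *%R k) (@sin R)); [exact: cl|exact: continuous_sin].
Qed.

Definition modeCoef (p : {poly R}) (k h : R) : R[i] :=
  cintegral (- (h / 2)) (h / 2) (fun x => (p.[x / h])%:C * expi (k * x)).

(** The integrand is a function of $x$ times a function of $y$; pulling constants out of the inner
    and then the outer integral factors it. *)
Lemma dofModeE K (b : 'I_K.+1 -> {poly R}) kx ky dx dy Q k l m :
  dofMode b kx ky dx dy Q (enum_rank (k, l, m)) 0 =
  Q m 0 * ((dx * dy)^-1)%:C * (modeCoef (b k) kx dx * modeCoef (b l) ky dy).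
Proof.
rewrite mxE enum_rankK; congr (_ * _).
transitivity (cintegral (- (dx / 2)) (dx / 2)
    (fun x => modeCoef (b l) ky dy * ((b k).[x / dx]%:C * expi (kx * x)))).
  congr cintegral; apply/funext => x.
  rewrite [RHS]mulrC -cintegralZl; last exact: ccontinuous_mode.
  by congr cintegral; apply/funext => y; ring.
rewrite cintegralZl; last exact: ccontinuous_mode.
by rewrite -/(modeCoef (b k) kx dx) mulrC.
Qed.
End ModeIntegrals.

(** * The evolution matrix as operators on coefficient matrices *)

Section EvolutionMatrix.
Local Open Scope sesquilinear_scope.

Variables (R : realType) (kx ky : R).
Notation C := R[i].
Notation r3 := ((Num.sqrt 3 : R)%:C).
Notation r5 := ((Num.sqrt 5 : R)%:C).
Notation E h := (evolMx (@basis2 R) 1%:M 1%:M kx ky h h).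

(** Regroups the flat vector into the coefficient matrix of one component, the form used in the
    energy argument. *)
Definition dofComp (q : 'cV[C]_(ndof 2)) (m : 'I_3) : 'M[C]_3 :=
  \matrix_(k, l) q (enum_rank (k, l, m)) 0.

Definition dofVec (U V P : 'M[C]_3) : 'cV[C]_(ndof 2) :=
  \col_r let: (k, l, m) := enum_val r in
    (nth 0 [:: U; V; P] (m : 'I_3)) (k : 'I_3) (l : 'I_3).

Lemma dofVecE U V P k l m :
  dofVec U V P (enum_rank (k, l, m)) 0 = (nth 0 [:: U; V; P] m) k l.
Proof. by rewrite mxE enum_rankK. Qed.

Lemma dofComp_vec U V P m : dofComp (dofVec U V P) m = nth 0 [:: U; V; P] m.
Proof. by apply/matrixP => k l; rewrite mxE dofVecE. Qed.

Lemma dof_ext (q q' : 'cV[C]_(ndof 2)) :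
  (forall m, dofComp q m = dofComp q' m) -> q = q'.
Proof.
move=> e; apply/matrixP => i j; rewrite ord1 -(enum_valK i).
case: (enum_val i) => [[k l] m].
by have /matrixP/(_ k l) := e m; rewrite !mxE.
Qed.

Lemma sqrt3J : Num.conj r3 = r3.
Proof. by apply/CrealP; rewrite complex_real. Qed.
Lemma sqrt5J : Num.conj r5 = r5.
Proof. by apply/CrealP; rewrite complex_real. Qed.
Lemma sqrt3_sqr : r3 ^+ 2 = 3.
Proof. by rewrite -rmorphXn /= sqr_sqrtr // rmorph_nat. Qed.
Lemma sqrt5_sqr : r5 ^+ 2 = 5.
Proof. by rewrite -rmorphXn /= sqr_sqrtr // rmorph_nat. Qed.

Definition hcos (k h : R) : C := (cos (k * h / 2))%:C.
Definition hsin (k h : R) : C := (sin (k * h / 2))%:C.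

Lemma hcosJ k h : Num.conj (hcos k h) = hcos k h.
Proof. by apply/CrealP; rewrite complex_real. Qed.
Lemma hsinJ k h : Num.conj (hsin k h) = hsin k h.
Proof. by apply/CrealP; rewrite complex_real. Qed.
Lemma hcossin k h : hcos k h ^+ 2 + hsin k h ^+ 2 = 1.
Proof. by rewrite -!rmorphXn -rmorphD /= cos2Dsin2. Qed.

Lemma expi_transl k h : expi (k * h) = transl (hcos k h) (hsin k h).
Proof.
rewrite /transl /expi -complexiE.
have -> : k * h = (k * h / 2) *+ 2 by rewrite -mulr_natr; field.
rewrite cos_mulr2n sin_mulr2n /hcos /hsin.
set c := cos _; set s := sin _.
have cs : c ^+ 2 + s ^+ 2 = 1 by rewrite cos2Dsin2.
rewrite expr2; simpc; congr (_ +i* _).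
  by rewrite -cs; ring.
by ring.
Qed.

Lemma expiJ (k h : R) : expi (k * h) * Num.conj (expi (k * h)) = 1.
Proof. by rewrite expi_transl translJ ?hcosJ ?hsinJ ?hcossin. Qed.

Lemma expi_neq0 (k h : R) : expi (k * h) != 0.
Proof.
by apply: contra_eq_neq (expiJ k h) => ->; rewrite mul0r eq_sym oner_neq0.
Qed.

(** The first flux factor is the jump vector $w$, up to scaling. Paired with the average and joined
    by the volume term it gives [centralMx]; paired with the identity dissipation, whose factor is
    $w^*$, it gives $ww^*$. *)
Lemma fluxTermE (J : 'M[C]_3) (k h : R) (i a : 'I_3) m n : h != 0 ->
  let t := expi (k * h) in let w := jumpVec (faceR r3 r5) (faceL r3 r5) t in
  2 * h%:C * fluxTerm (@basis2 R) J 1%:M t h i a m n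
    - 2 * stiffMx r3 r5 i a * J m n =
  centralMx (stiffMx r3 r5) (faceR r3 r5) (faceL r3 r5) t i a * J m n
  + (w *m w ^t*) i a * (m == n)%:R.
Proof.
move=> h0 t w.
have hC : h%:C != 0 by rewrite (fmorph_eq0 (real_complex R)).
have t0 : t != 0 := expi_neq0 k h.
rewrite /w (jumpVec_trmxC (faceRJ sqrt3J sqrt5J) (faceLJ sqrt3J sqrt5J) (expiJ k h)).
rewrite /fluxTerm !bR_basis2 !bL_basis2 -/t /centralMx /jumpVec.
move: (faceR r3 r5) (faceL r3 r5) (stiffMx r3 r5) => FR FL G.
rewrite !mxE !big_ord1 !mxE -mulr_natr.
by field; rewrite hC t0.
Qed.

Lemma evolBlock_entry K (b : 'I_K.+1 -> {poly R}) Dx Dy dx dy k l a c m n :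
  evolBlock b Dx Dy kx ky dx dy k l a c m n =
  - (dx^-1 * massM b l c * gradG b k a)%:C * Jx R m n
  - (dy^-1 * massM b k a * gradG b l c)%:C * Jy R m n
  + (massM b l c)%:C * fluxTerm b (Jx R) Dx (expi (kx * dx)) dx k a m n
  + (massM b k a)%:C * fluxTerm b (Jy R) Dy (expi (ky * dy)) dy l c m n.
Proof.
rewrite /evolBlock.
move: (Jx R) (Jy R) (fluxTerm _ _ _ _ _ _ _) (fluxTerm _ _ _ _ _ _ _) => J1 J2 F1 F2.
by rewrite !mxE.
Qed.

Lemma scaled_block (F : fieldType) (z g1 g2 j1 j2 f1 f2 d1 d2 e1 e2 : F) : z != 0 ->
  2 * z * f1 - 2 * g1 * j1 = e1 -> 2 * z * f2 - 2 * g2 * j2 = e2 ->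
  2 * z * (- (z^-1 * d1 * g1) * j1 - z^-1 * d2 * g2 * j2 + d1 * f1 + d2 * f2) =
  d1 * e1 + d2 * e2.
Proof. by move=> z0 <- <-; field. Qed.

Lemma sum_delta (V : pzRingType) (I : finType) (i : I) (F : I -> V) :
  \sum_j (i == j)%:R * F j = F i.
Proof.
rewrite (bigD1 i) //= eqxx mul1r big1 ?addr0 // => j /negPf.
by rewrite eq_sym => ->; rewrite mul0r.
Qed.

Lemma assembleE (F : comNzRingType) (SX SY X Y : 'M[F]_3) (J1 J2 : 'I_3 -> F)
    (Q : 'I_3 -> 'M[F]_3) m k l :
  \sum_n (\sum_a (X k a * J1 n + SX k a * (m == n)%:R) * Q n a l
    + \sum_c (Y l c * J2 n + SY l c * (m == n)%:R) * Q n k c) =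
  (SX *m Q m + Q m *m SY^T
    + \sum_n (J1 n *: (X *m Q n) + J2 n *: (Q n *m Y^T))) k l.
Proof.
rewrite mxE summxE.
have -> : (SX *m Q m + Q m *m SY^T) k l =
    \sum_n (m == n)%:R * ((SX *m Q n) k l + (Q n *m SY^T) k l).
  by rewrite sum_delta mxE.
rewrite -big_split; apply: eq_bigr => n _ /=; rewrite !mxE.
rewrite mulrDr [RHS]addrACA; congr (_ + _).
  rewrite !mulr_sumr -big_split; apply: eq_bigr => i _ /=; ring.
by rewrite !mulr_sumr -big_split; apply: eq_bigr => i _ /=; rewrite ?mxE; ring.
Qed.

(** By orthonormality the $x$ terms of a block act on the first index only and the $y$ terms on the
    second: multiplication from the left and, transposed, from the right. *)
Lemma evolMx_dofComp h (q : 'cV[C]_(ndof 2)) k l m : h != 0 ->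
  let tx := expi (kx * h) in let ty := expi (ky * h) in
  let X := centralMx (stiffMx r3 r5) (faceR r3 r5) (faceL r3 r5) tx in
  let Y := centralMx (stiffMx r3 r5) (faceR r3 r5) (faceL r3 r5) ty in
  let D := dissip (jumpVec (faceR r3 r5) (faceL r3 r5) tx)
    (jumpVec (faceR r3 r5) (faceL r3 r5) ty) in
  2 * h%:C * (E h *m q) (enum_rank (k, l, m)) 0 =
  (D (dofComp q m)
   + \sum_n (Jx R m n *: (X *m dofComp q n) + Jy R m n *: (dofComp q n *m Y^T))) k l.
Proof.
move=> h0 tx ty X Y D.
have hC : h%:C != 0 by rewrite (fmorph_eq0 (real_complex R)).
set wx := jumpVec _ _ tx in D *; set wy := jumpVec _ _ ty in D *.
pose A a n := X k a * Jx R m n + (wx *m wx ^t*) k a * (m == n)%:R.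
pose B c n := Y l c * Jy R m n + (wy *m wy ^t*) l c * (m == n)%:R.
have blockE a c n : 2 * h%:C *
    evolBlock (@basis2 R) 1%:M 1%:M kx ky h h k l a c m n =
    (l == c)%:R * A a n + (k == a)%:R * B c n.
  rewrite evolBlock_entry !massM_basis2 !rmorphM !rmorph_nat fmorphV /=.
  rewrite !gradG_basis2.
  exact: (scaled_block _ _ hC (fluxTermE (Jx R) kx k a m n h0)
    (fluxTermE (Jy R) ky l c m n h0)).
have -> : 2 * h%:C * (E h *m q) (enum_rank (k, l, m)) 0 =
    \sum_n (\sum_a A a n * dofComp q n a l + \sum_c B c n * dofComp q n k c).
  rewrite mxE (reindex (@enum_rank (dof 2))) /=; last first.
    by exists enum_val => i _; rewrite ?enum_valK ?enum_rankK.
  rewrite mulr_sumr.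
  transitivity (\sum_(p : 'I_3 * 'I_3) \sum_(n : 'I_3)
      ((l == p.2)%:R * A p.1 n + (k == p.1)%:R * B p.2 n) * dofComp q n p.1 p.2).
    rewrite pair_bigA /=; apply: eq_bigr => -[[a c] n] _ /=.
    by rewrite !mxE !enum_rankK mulrA blockE.
  rewrite exchange_big; apply: eq_bigr => n _ /=.
  rewrite -(pair_bigA _ (fun a c => ((l == c)%:R * A a n + (k == a)%:R * B c n)
    * dofComp q n a c)) /=.
  transitivity (\sum_a (A a n * dofComp q n a l
      + (k == a)%:R * \sum_c B c n * dofComp q n a c)).
    apply: eq_bigr => a _; rewrite mulr_sumr -(sum_delta l (fun c => A a n * _ c)).
    by rewrite -big_split; apply: eq_bigr => c _ /=; ring.
  by rewrite big_split /= sum_delta.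
exact: assembleE.
Qed.
End EvolutionMatrix.

(** * Calculus of powers of the mesh width *)

Section BigO.
Variable R : realType.
Implicit Types (f g : R -> R[i]) (z : R[i]).
Notation normc := (@Normc.normc R).

Lemma normc_ge0 z : 0 <= normc z.
Proof. by case: z => a b; exact: sqrtr_ge0. Qed.

Lemma normc_gt0 z : z != 0 -> 0 < normc z.
Proof.
move=> z0; rewrite lt_neqAle normc_ge0 andbT eq_sym; apply: contra_neq z0.
exact: Normc.eq0_normc.
Qed.

Lemma normc_real (x : R) : normc x%:C = `|x|.
Proof. by rewrite /= expr0n addr0 sqrtr_sqr. Qed.

Lemma isO_powP f n : isO_pow f n <->
  exists2 M, 0 < M & \forall h \near 0^'+, normc (f h) <= M * h ^+ n.
Proof.
rewrite /isO_pow; split=> [/eqO_exP[M M0 H]|[M M0 H]];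
  [exists M => //|apply/eqO_exP; exists M => //].
  near=> h; have h0 : 0 < h by [].
  have : `|normc (f h)| <= M * `|h ^+ n| by near: h.
  by rewrite !ger0_norm ?normc_ge0 // exprn_ge0 // ltW.
near=> h; have h0 : 0 < h by [].
rewrite !ger0_norm ?normc_ge0 ?exprn_ge0 ?(ltW h0) //.
by near: h.
Unshelve. all: by end_near. Qed.

Lemma isO_pow_near f g n : (\forall h \near 0^'+, f h = g h) ->
  isO_pow f n -> isO_pow g n.
Proof.
move=> fg /isO_powP[M M0 H]; apply/isO_powP; exists M => //.
near=> h; rewrite -(_ : f h = g h); first by near: h.
by near: h.
Unshelve. all: by end_near. Qed.

Lemma isO_powD f g n : isO_pow f n -> isO_pow g n ->
  isO_pow (fun h => f h + g h) n.
Proof.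
move=> /isO_powP[M M0 Hf] /isO_powP[N N0 Hg]; apply/isO_powP.
exists (M + N); first exact: addr_gt0.
near=> h; apply: le_trans (le_normcD _ _) _; rewrite mulrDl; apply: lerD.
  by near: h.
by near: h.
Unshelve. all: by end_near. Qed.

Lemma isO_powM f g m n : isO_pow f m -> isO_pow g n ->
  isO_pow (fun h => f h * g h) (m + n).
Proof.
move=> /isO_powP[M M0 Hf] /isO_powP[N N0 Hg]; apply/isO_powP.
exists (M * N); first exact: mulr_gt0.
near=> h; rewrite Normc.normcM exprD mulrACA; apply: ler_pM; rewrite ?normc_ge0 //.
  by near: h.
by near: h.
Unshelve. all: by end_near. Qed.

Lemma isO_powN f n : isO_pow f n -> isO_pow (fun h => - f h) n.
Proof.
move=> /isO_powP[M M0 H]; apply/isO_powP; exists M => //.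
by near=> h; rewrite normcN; near: h.
Unshelve. all: by end_near. Qed.

Lemma isO_pow_weak f m n : (m <= n)%N -> isO_pow f n -> isO_pow f m.
Proof.
move=> mn /isO_powP[M M0 H]; apply/isO_powP; exists M => //.
near=> h; have h0 : 0 < h by [].
have h1 : h < 1 by near: h; exact: nbhs_right_lt.
have : normc (f h) <= M * h ^+ n by near: h.
move=> /le_trans; apply; rewrite ler_wpM2l ?(ltW M0) //.
by rewrite ler_wiXn2l // ltW.
Unshelve. all: by end_near. Qed.

Lemma isO_pow_cst z : isO_pow (fun=> z) 0.
Proof.
apply/isO_powP; exists (normc z + 1); first by rewrite ltr_wpDl ?normc_ge0.
by near=> h; rewrite expr0 mulr1 lerDl.
Unshelve. all: by end_near. Qed.

Lemma isO_pow0 n : isO_pow (fun _ : R => 0) n.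
Proof.
apply/isO_powP; exists 1 => //; near=> h; have h0 : 0 < h by [].
by rewrite Normc.normc0 mul1r exprn_ge0 ?ltW.
Unshelve. all: by end_near. Qed.

Lemma isO_pow_real (f : R -> R) (M : R) n :
  (\forall h \near 0^'+, `|f h| <= M * h ^+ n) -> isO_pow (fun h => (f h)%:C) n.
Proof.
move=> H; apply/isO_powP; exists (`|M| + 1); first by rewrite ltr_wpDl.
near=> h; have h0 : 0 < h by [].
rewrite normc_real; have : `|f h| <= M * h ^+ n by near: h.
move/le_trans; apply; rewrite ler_wpM2r ?exprn_ge0 ?(ltW h0) //.
by apply: le_trans (ler_norm M) _; rewrite lerDl.
Unshelve. all: by end_near. Qed.

Lemma isO_pow_id : isO_pow (fun h : R => h%:C) 1.
Proof.
apply: (@isO_pow_real _ 1); near=> h; have h0 : 0 < h by [].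
by rewrite gtr0_norm // mul1r.
Unshelve. all: by end_near. Qed.

Lemma isO_pow_complex (f g : R -> R) n : isO_pow (fun h => (f h)%:C) n ->
  isO_pow (fun h => (g h)%:C) n -> isO_pow (fun h => f h +i* g h) n.
Proof.
move=> Hf Hg; apply: (@isO_pow_near (fun h => (f h)%:C + 'i%C * (g h)%:C)).
  by apply: nearW => h; rewrite [RHS]complexE.
apply: isO_powD => //; rewrite -[n]add0n; apply: isO_powM => //.
exact: isO_pow_cst.
Qed.

(** Boundedness of both functions is included so that the relation passes to products. *)
Definition eqO2 f g :=
  [/\ isO_pow f 0, isO_pow g 0 & isO_pow (fun h => f h - g h) 2].

Lemma eqO2I f g : isO_pow g 0 -> isO_pow (fun h => f h - g h) 2 -> eqO2 f g.
Proof.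
move=> g0 fg; split=> //.
apply: (@isO_pow_near (fun h => (f h - g h) + g h)).
  by apply: nearW => h; rewrite subrK.
by apply: isO_powD => //; exact: isO_pow_weak fg.
Qed.

Lemma eqO2_near f f' g : (\forall h \near 0^'+, f h = f' h) -> eqO2 f g -> eqO2 f' g.
Proof.
move=> ff' [f0 g0 fg]; split=> //; first exact: isO_pow_near f0.
apply: isO_pow_near fg; near=> h; congr (_ - _).
by near: h.
Unshelve. all: by end_near. Qed.

Lemma eqO2_sym f g : eqO2 f g -> eqO2 g f.
Proof.
case=> f0 g0 fg; split=> //; apply: isO_pow_near (isO_powN fg).
by apply: nearW => h; rewrite opprB.
Qed.

Lemma eqO2_trans g f k : eqO2 f g -> eqO2 g k -> eqO2 f k.
Proof.
case=> f0 g0 fg [_ k0 gk]; split=> //; apply: isO_pow_near (isO_powD fg gk).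
by apply: nearW => h; rewrite addrA subrK.
Qed.

Lemma eqO2_cst z : eqO2 (fun=> z) (fun=> z).
Proof.
apply: eqO2I; first exact: isO_pow_cst.
by apply: isO_pow_near (isO_pow0 2); apply: nearW => h; rewrite subrr.
Qed.

Lemma eqO2D f f' g g' : eqO2 f f' -> eqO2 g g' ->
  eqO2 (fun h => f h + g h) (fun h => f' h + g' h).
Proof.
case=> f0 f'0 ff [g0 g'0 gg]; split; try exact: isO_powD.
apply: isO_pow_near (isO_powD ff gg).
by apply: nearW => h; ring.
Qed.

Lemma eqO2M f f' g g' : eqO2 f f' -> eqO2 g g' ->
  eqO2 (fun h => f h * g h) (fun h => f' h * g' h).
Proof.
case=> f0 f'0 ff [g0 g'0 gg]; split; try by rewrite -[0%N]addn0; exact: isO_powM.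
apply: isO_pow_near (isO_powD (isO_powM ff g0) (isO_powM gg f'0)).
by apply: nearW => h; ring.
Qed.

(** For $h<1$ and $h<|z|/(2M)$ the deviation is at most $Mh^2\le Mh\le|z|/2$. *)
Lemma eqO2_neq0 f z : z != 0 -> eqO2 f (fun=> z) ->
  \forall h \near 0^'+, normc z / 2 <= normc (f h).
Proof.
move=> z0 [_ _ /isO_powP[M M0 H]].
have nz := normc_gt0 z0.
near=> h; have h0 : 0 < h by [].
have h1 : h < 1 by near: h; exact: nbhs_right_lt.
have hM : h < normc z / (2 * M).
  by near: h; apply: nbhs_right_lt; rewrite divr_gt0 // mulr_gt0.
have hf : normc (f h - z) <= M * h ^+ 2 by near: h.
have : normc z <= normc (f h) + normc (f h - z).
  rewrite -[X in normc X <= _](subrK (f h)) addrC.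
  by apply: le_trans (le_normcD _ _) _; rewrite -[z - _]opprB normcN.
have : M * h ^+ 2 <= normc z / 2.
  apply: le_trans (_ : M * h <= _); first by rewrite ler_pM2l // expr2 ler_piMl ?ltW.
  move: hM; rewrite ltr_pdivlMr ?mulr_gt0 //; nra.
lra.
Unshelve. all: by end_near. Qed.

Lemma eqO2_near_neq0 f z : z != 0 -> eqO2 f (fun=> z) ->
  \forall h \near 0^'+, f h != 0.
Proof.
move=> z0 fz; near=> h.
have : normc z / 2 <= normc (f h) by near: h; exact: eqO2_neq0.
apply: contraTneq => ->; by rewrite Normc.normc0 -ltNge divr_gt0 // normc_gt0.
Unshelve. all: by end_near. Qed.

(** The lower bound $|z|/2$ on $|f|$ bounds the inverse, and $1/f-1/z=-(f-z)/(fz)$. *)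
Lemma eqO2V f z : z != 0 -> eqO2 f (fun=> z) ->
  eqO2 (fun h => (f h)^-1) (fun=> z^-1).
Proof.
move=> z0 fz; have [_ _ d] := fz.
have nz := normc_gt0 z0.
have Vb : isO_pow (fun h => (f h)^-1) 0.
  apply/isO_powP; exists (2 / normc z); first by rewrite divr_gt0.
  near=> h; rewrite expr0 mulr1 Normc.normcV -[2 / _]invrK invf_div.
  rewrite lef_pV2 ?posrE ?divr_gt0 //; last first.
    apply: (@lt_le_trans _ _ (normc z / 2)); first by rewrite divr_gt0.
    by near: h; exact: eqO2_neq0.
  by near: h; exact: eqO2_neq0.
apply: eqO2I; first exact: isO_pow_cst.
apply: isO_pow_near (isO_powM (isO_powM d Vb) (isO_pow_cst (- z^-1))).
near=> h; have f0 : f h != 0 by near: h; exact: eqO2_near_neq0 z0 fz.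
by field; rewrite z0 f0.
Unshelve. all: by end_near. Qed.
End BigO.

Lemma eqO2_eq (R : realType) (f f' g g' : R -> R[i]) :
  (forall h, f h = f' h) -> (forall h, g h = g' h) -> eqO2 f g -> eqO2 f' g'.
Proof. by move=> /funext -> /funext ->. Qed.

(** * Expansions of the profiles and of the moments *)

Section Asymptotics.
Variable R : realType.
Implicit Types (k h : R).
Notation C := R[i].
Notation r3R := (Num.sqrt 3 : R).
Notation r5R := (Num.sqrt 5 : R).
Notation r3 := (r3R%:C).
Notation r5 := (r5R%:C).

Let r30 : r3R != 0. Proof. by rewrite gt_eqF // sqrtr_gt0. Qed.
Let r50 : r5R != 0. Proof. by rewrite gt_eqF // sqrtr_gt0. Qed.

Lemma hcos_eqO2 k : eqO2 (hcos k) (fun=> 1).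
Proof.
apply: eqO2I; first exact: isO_pow_cst.
have : isO_pow (fun h => (cos (k * h / 2) - 1)%:C) 2.
  apply: (@isO_pow_real _ _ (`|k / 2| ^+ 2)); apply: nearW => h.
  apply: le_trans (cos_dist1 _) _.
  by rewrite mulrAC normrM exprMn ler_wpM2l ?sqr_ge0 // real_normK ?num_real.
by apply: isO_pow_near; apply: nearW => h; rewrite rmorphB rmorph1.
Qed.

Lemma hsin_isO3 k : isO_pow (fun h => (sin (k * h / 2) - k * h / 2)%:C) 3.
Proof.
apply: (@isO_pow_real _ _ (`|k / 2| ^+ 3)); near=> h; have h0 : 0 < h by [].
apply: le_trans (sin_dist_id _) _.
by rewrite mulrAC normrM exprMn (gtr0_norm h0).
Unshelve. all: by end_near. Qed.

Lemma isO_pow_scale (z : C) f n : isO_pow f n -> isO_pow (fun h : R => z * f h) n.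
Proof. by rewrite -[n in X in _ -> X]add0n; apply: isO_powM; exact: isO_pow_cst. Qed.

Lemma hsin_linear k : eqO2 (hsin k) (fun h => (k / 2)%:C * h%:C).
Proof.
apply: eqO2I.
  by apply: isO_pow_scale; apply: isO_pow_weak (isO_pow_id R).
apply: (@isO_pow_weak _ _ 2 3 isT); apply: isO_pow_near (hsin_isO3 k).
by apply: nearW => h; rewrite rmorphB -rmorphM [X in _ = _ - X%:C]mulrAC.
Qed.

(** The sine remainder is cubic, so dividing by $h$ still leaves second order. *)
Lemma hsin_eqO2 k : eqO2 (fun h => (2 / h)%:C * hsin k h) (fun=> k%:C).
Proof.
apply: eqO2I; first exact: isO_pow_cst.
have : isO_pow (fun h => (2 / h * (sin (k * h / 2) - k * h / 2))%:C) 2.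
  apply: (@isO_pow_real _ _ (2 * `|k / 2| ^+ 3)); near=> h; have h0 : 0 < h by [].
  rewrite normrM gtr0_norm ?divr_gt0 //.
  apply: le_trans (ler_wpM2l _ (sin_dist_id _)) _; first by rewrite ltW ?divr_gt0.
  rewrite (mulrAC k h) normrM exprMn (gtr0_norm h0) le_eqVlt; apply/orP; left.
  by apply/eqP; field; rewrite gt_eqF.
apply: isO_pow_near; near=> h; have h0 : 0 < h by [].
rewrite /hsin -rmorphM -rmorphB; congr (_ %:C); field.
by rewrite gt_eqF.
Unshelve. all: by end_near. Qed.

(* First-order Taylor polynomial of the i-th moment of [exp (i k x)] over a cell. *)
Definition mom1 k (i : 'I_3) h : C :=
  [:: 1; 'i%R / r3 * ((k / 2)%:C * h%:C); 0]`_i.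

Lemma eqO2_scale (z : C) f g : eqO2 f g -> eqO2 (fun h : R => z * f h) (fun h => z * g h).
Proof. by apply: eqO2M; exact: eqO2_cst. Qed.

Lemma linProfile_eqO2 k i :
  eqO2 (fun h => linProfile r3 (hcos k h) (hsin k h) i 0) (mom1 k i).
Proof.
move: i; apply: ord3P; rewrite /mom1 /=.
- apply: eqO2_near (hcos_eqO2 k); apply: nearW => h; by rewrite mxE.
- apply: eqO2_near (eqO2_scale ('i%R / r3) (hsin_linear k)).
  by apply: nearW => h; rewrite mxE /= mulrAC.
- apply: eqO2_near (eqO2_cst 0); apply: nearW => h; by rewrite mxE.
Qed.

Lemma hsin_sqr_eqO2 k : eqO2 (fun h => hsin k h ^+ 2) (fun=> 0).
Proof.
have [_ _ H] := hsin_linear k.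
have S : isO_pow (hsin k) 1.
  have := isO_powD (isO_pow_weak (isT : (1 <= 2)%N) H)
    (isO_pow_scale ((k / 2)%:C) (isO_pow_id R)).
  by apply: isO_pow_near; apply: nearW => h; rewrite subrK.
apply: eqO2I; first exact: isO_pow_cst.
apply: isO_pow_near (isO_powM S S).
by apply: nearW => h; rewrite subr0 expr2.
Qed.

(** As $c=1+O(h^2)$ and $s^2=O(h^2)$, the quadratic profile has to this order the coefficients of
    the linear one. *)
Lemma quadProfile_eqO2 k i :
  eqO2 (fun h => quadProfile r3 r5 (hcos k h) (hsin k h) i 0) (mom1 k i).
Proof.
move: i; apply: ord3P; rewrite /mom1 /=.
- have := eqO2D (eqO2M (hcos_eqO2 k) (hcos_eqO2 k))
    (eqO2_scale (3^-1) (hsin_sqr_eqO2 k)).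
  rewrite mul1r mulr0 addr0; apply: eqO2_near; apply: nearW => h.
  by rewrite mxE /= [_ / 3]mulrC expr2.
- have := eqO2M (eqO2_scale ('i%R / r3) (hsin_linear k)) (hcos_eqO2 k).
  apply: eqO2_eq => h; last by rewrite mulr1.
  by rewrite mxE /=; ring.
- have := eqO2_scale (- (3 * r5)^-1) (hsin_sqr_eqO2 k).
  apply: eqO2_eq => h; last by rewrite mulr0.
  by rewrite mxE /= mulrC mulrN mulNr.
Qed.

(** This and the next lemma give the moments of the real and imaginary parts of $1+ikx$, the Taylor
    polynomial of the wave. *)
Lemma expi_moment_Re i h : 0 < h ->
  \int[lebesgue_measure]_(x in `[- (h / 2), h / 2]) ((@basis2 R i).[x / h]) =
  h * (i == o0)%:R.
Proof.
move=> h0; have hn := gt_eqF h0; have d0 : 0 < h / 2 by rewrite divr_gt0.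
move: i; apply: ord3P => /=.
- rewrite (@Rintegral_quartic R 1 0 0 0 0) => [||x] //; first by field.
  by rewrite basis2E; ring.
- rewrite (@Rintegral_quartic R 0 (2 * r3R / h) 0 0 0) => [||x] //.
    by rewrite mulr0; ring.
  by rewrite basis2E; field; rewrite hn.
- rewrite (@Rintegral_quartic R (- r5R / 2) 0 (6 * r5R / h ^+ 2) 0 0) => [||x] //.
    by field; rewrite hn.
  by rewrite basis2E; field; rewrite hn.
Qed.

Lemma expi_moment_Im k i h : 0 < h ->
  \int[lebesgue_measure]_(x in `[- (h / 2), h / 2])
    ((@basis2 R i).[x / h] * (k * x)) =
  h * ((i == o1)%:R * (k / 2 * h / r3R)).
Proof.
move=> h0; have hn := gt_eqF h0; have d0 : 0 < h / 2 by rewrite divr_gt0.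
have r3V : r3R^-1 = r3R / 3.
  by apply: (mulfI r30); rewrite divff // mulrA -expr2 sqr_sqrtr // divff.
move: i; apply: ord3P => /=.
- rewrite (@Rintegral_quartic R 0 k 0 0 0) => [||x] //; first by ring.
  by rewrite basis2E; ring.
- rewrite (@Rintegral_quartic R 0 0 (2 * r3R / h * k) 0 0) => [||x] //.
    by rewrite r3V; field; rewrite hn.
  by rewrite basis2E; field; rewrite hn.
- rewrite (@Rintegral_quartic R 0 (- r5R / 2 * k) 0 (6 * r5R / h ^+ 2 * k) 0)
    => [||x] //.
    by ring.
  by rewrite basis2E; field; rewrite hn.
Qed.

(** On a cell $|kx|\le|k|h/2$ and the basis is bounded by [M], so replacing the cosine by 1 and the
    sine by its argument changes the averages by $O(h^2)$ and $O(h^3)$. *)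
Lemma modeCoef_eqO2 k i :
  eqO2 (fun h => (h^-1)%:C * modeCoef (@basis2 R i) k h) (mom1 k i).
Proof.
have m0 : isO_pow (mom1 k i) 0 by have [] := linProfile_eqO2 k i.
apply: eqO2I => //.
have [M M0 HM] := basis2_bounded R i.
have ccos : continuous (fun x : R => cos (k * x)).
  move=> x; apply: (@continuous_comp R R R ( *%R k) (@cos R)).
    by apply: cvgM; [exact: cvg_cst|exact: cvg_id].
  exact: continuous_cos.
have csin : continuous (fun x : R => sin (k * x)).
  move=> x; apply: (@continuous_comp R R R ( *%R k) (@sin R)).
    by apply: cvgM; [exact: cvg_cst|exact: cvg_id].
  exact: continuous_sin.
have cl : continuous (fun x : R => k * x).
  by move=> x; apply: cvgM; [exact: cvg_cst|exact: cvg_id].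
have cb h : continuous (fun x : R => (@basis2 R i).[x / h]).
  move=> x; apply: (@continuous_comp R R R (fun x : R => x / h) (horner _)).
    by apply: cvgM; [exact: cvg_id|exact: cvg_cst].
  exact: continuous_horner.
have cM (f g : R -> R) : continuous f -> continuous g -> continuous (fun x => f x * g x).
  by move=> cf cg x; apply: cvgM; [exact: cf|exact: cg].
have bnd h x : 0 < h -> - (h / 2) <= x <= h / 2 ->
    `|(@basis2 R i).[x / h]| <= M /\ `|k * x| <= `|k / 2| * h.
  move=> h0 /andP[x1 x2]; split.
    apply: HM; rewrite ler_norml ler_pdivlMr // ler_pdivrMr //.
    by apply/andP; split; lra.
  rewrite !normrM -mulrA ler_wpM2l // ler_norml.
  rewrite [`|2^-1|]gtr0_norm ?invr_gt0 //.
  by apply/andP; split; lra.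
have Re_est : isO_pow (fun h => (h^-1 *
    (\int[lebesgue_measure]_(x in `[- (h / 2), h / 2])
      ((@basis2 R i).[x / h] * cos (k * x))) - (i == o0)%:R)%:C) 2.
  apply: (@isO_pow_real _ _ (M * `|k / 2| ^+ 2)); near=> h; have h0 : 0 < h by [].
  have hn := gt_eqF h0.
  have -> : (i == o0)%:R = h^-1 * (h * (i == o0)%:R) :> R by rewrite mulKf ?hn.
  rewrite -expi_moment_Re // -mulrBr normrM gtr0_norm ?invr_gt0 //.
  rewrite mulrC ler_pdivrMr //.
  apply: le_trans (Rintegral_dist (e := M * `|k / 2| ^+ 2 * h ^+ 2) _ _ _ _) _.
  - by lra.
  - by apply: cM.
  - by [].
  - move=> x /(bnd _ _ h0)[b1 b2].
    rewrite -[X in _ - X]mulr1 -mulrBr normrM -mulrA ler_pM //.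
    by apply: le_trans (cos_dist1 _) _; rewrite -exprMn lerXn2r ?nnegrE // mulr_ge0 // ltW.
  - by rewrite ler_wpM2l ?mulr_ge0 ?sqr_ge0 ?(ltW M0) //; lra.
have Im_est : isO_pow (fun h => (h^-1 *
    (\int[lebesgue_measure]_(x in `[- (h / 2), h / 2])
      ((@basis2 R i).[x / h] * sin (k * x)))
      - (i == o1)%:R * (k / 2 * h / r3R))%:C) 3.
  apply: (@isO_pow_real _ _ (M * `|k / 2| ^+ 3)); near=> h; have h0 : 0 < h by [].
  have hn := gt_eqF h0.
  have -> : (i == o1)%:R * (k / 2 * h / r3R) =
    h^-1 * (h * ((i == o1)%:R * (k / 2 * h / r3R))) :> R by rewrite mulKf ?hn.
  rewrite -(expi_moment_Im k) // -mulrBr normrM gtr0_norm ?invr_gt0 //.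
  rewrite mulrC ler_pdivrMr //.
  apply: le_trans (Rintegral_dist (e := M * `|k / 2| ^+ 3 * h ^+ 3) _ _ _ _) _.
  - by lra.
  - by apply: cM.
  - by apply: cM.
  - move=> x /(bnd _ _ h0)[b1 b2].
    rewrite -mulrBr normrM -mulrA ler_pM //.
    by apply: le_trans (sin_dist_id _) _; rewrite -exprMn lerXn2r ?nnegrE // mulr_ge0 // ltW.
  - by rewrite ler_wpM2l ?mulr_ge0 ?exprn_ge0 ?(ltW M0) ?(ltW h0) //; lra.
apply: isO_pow_near (isO_pow_complex Re_est (isO_pow_weak (isT : (2 <= 3)%N) Im_est)).
apply: nearW => h.
have -> : modeCoef (@basis2 R i) k h =
    (\int[lebesgue_measure]_(x in `[- (h / 2), h / 2])
      ((@basis2 R i).[x / h] * cos (k * x))) +i*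
    (\int[lebesgue_measure]_(x in `[- (h / 2), h / 2])
      ((@basis2 R i).[x / h] * sin (k * x))).
  rewrite /modeCoef /cintegral; congr (_ +i* _); apply: eq_Rintegral => x _ /=.
    by rewrite mul0r subr0.
  by rewrite mul0r addr0.
have -> : mom1 k i h = (i == o0)%:R +i* ((i == o1)%:R * (k / 2 * h / r3R)).
  rewrite /mom1 -complexiE; move: i {m0 M M0 HM cb bnd Re_est Im_est}.
  apply: ord3P => /=; rewrite ?mul0r //.
  rewrite mulrAC -mulrA -rmorphM -fmorphV -rmorphM /=; simpc.
  by [].
by simpc.
Unshelve. all: end_near.
Qed.
End Asymptotics.

(** * Components of the Jacobian terms *)

Section JacobianSums.
Variables (R : realType) (V : lmodType R[i]) (F G : 'I_3 -> V).

Lemma sumJ0 : \sum_n (Jx R o0 n *: F n + Jy R o0 n *: G n) = F o2.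
Proof. by rewrite sum3E !mxE /= !(scale0r, scale1r, addr0, add0r). Qed.
Lemma sumJ1 : \sum_n (Jx R o1 n *: F n + Jy R o1 n *: G n) = G o2.
Proof. by rewrite sum3E !mxE /= !(scale0r, scale1r, addr0, add0r). Qed.
Lemma sumJ2 : \sum_n (Jx R o2 n *: F n + Jy R o2 n *: G n) = F o0 + G o1.
Proof. by rewrite sum3E !mxE /= !(scale0r, scale1r, addr0, add0r). Qed.
End JacobianSums.

(** * The kernel of the evolution matrix *)

Section Kernel.
Variables (R : realType) (kx ky : R).
Notation C := R[i].
Notation r3 := ((Num.sqrt 3 : R)%:C).
Notation r5 := ((Num.sqrt 5 : R)%:C).
Notation E h := (evolMx (@basis2 R) 1%:M 1%:M kx ky h h).
Notation cx h := (hcos kx h).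
Notation sx h := (hsin kx h).
Notation cy h := (hcos ky h).
Notation sy h := (hsin ky h).

Lemma mem_mxker N (A : 'M[C]_N) q : (q \in mxker A) = (A *m q == 0).
Proof. by rewrite memv_ker lfunE. Qed.

(** Up to the nonzero factor $2h$, the three components of $\mathcal E\hat q$ are the left-hand
    sides in [stationary]. *)
Lemma evolMx_kerP h (q : 'cV[C]_(ndof 2)) : h != 0 ->
  E h *m q = 0 <-> stationary r3 r5 (cx h) (sx h) (cy h) (sy h)
    (dofComp q o0) (dofComp q o1) (dofComp q o2).
Proof.
move=> h0; have hC : 2 * h%:C != 0.
  by rewrite mulf_neq0 ?pnatr_eq0 // (fmorph_eq0 (real_complex R)).
have entry k l m := evolMx_dofComp kx ky q k l m h0.
rewrite /stationary -!expi_transl; cbv zeta in entry.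
set X := centralMx _ _ _ _ in entry *; set Y := centralMx _ _ _ _ in entry *.
set D := dissip _ _ in entry *.
have e0 k l : 2 * h%:C * (E h *m q) (enum_rank (k, l, o0)) 0 =
    (D (dofComp q o0) + X *m dofComp q o2) k l.
  by rewrite entry sumJ0.
have e1 k l : 2 * h%:C * (E h *m q) (enum_rank (k, l, o1)) 0 =
    (D (dofComp q o1) + dofComp q o2 *m Y^T) k l.
  by rewrite entry sumJ1.
have e2 k l : 2 * h%:C * (E h *m q) (enum_rank (k, l, o2)) 0 =
    (D (dofComp q o2) + X *m dofComp q o0 + dofComp q o1 *m Y^T) k l.
  by rewrite entry sumJ2 addrA.
split=> [Eq0|[s0 s1 s2]].
  have z k l m : 2 * h%:C * (E h *m q) (enum_rank (k, l, m)) 0 = 0.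
    by rewrite Eq0 mxE mulr0.
  split; apply/matrixP => k l; rewrite [RHS]mxE.
  - exact: etrans (esym (e0 k l)) (z k l o0).
  - exact: etrans (esym (e1 k l)) (z k l o1).
  - exact: etrans (esym (e2 k l)) (z k l o2).
apply: dof_ext => m; apply/matrixP => k l; rewrite [LHS]mxE [RHS]mxE [RHS]mxE.
apply: (mulfI hC); rewrite mulr0; move: m.
apply: ord3P.
- by rewrite e0 s0 [LHS]mxE.
- by rewrite e1 s1 [LHS]mxE.
- by rewrite e2 s2 [LHS]mxE.
Qed.

(* The factor 2/h makes the limit at h = 0 equal to that of the mode. *)
Definition kerVec h : 'cV[C]_(ndof 2) :=
  dofVec ((2 / h)%:C *: statU r3 r5 (cx h) (sx h) (cy h) (sy h))
         ((2 / h)%:C *: statV r3 r5 (cx h) (sx h) (cy h) (sy h)) 0.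

(** Since $b_0=1$, this is the cell mean of $u$, which the projector preserves. *)
Definition refDof : 'I_(ndof 2) := enum_rank (o0, o0, o0).

Lemma stationaryZ (c s c' s' z : C) U V P :
  stationary r3 r5 c s c' s' U V P ->
  stationary r3 r5 c s c' s' (z *: U) (z *: V) (z *: P).
Proof.
rewrite /stationary /dissip => -[e0 e1 e2]; split.
- by rewrite -!scalemxAr -!scalemxAl -!scalerDr e0 scaler0.
- by rewrite -!scalemxAr -!scalemxAl -!scalerDr e1 scaler0.
- by rewrite -!scalemxAr -!scalemxAl -!scalerDr e2 scaler0.
Qed.

Lemma kerVec_ker h : h != 0 -> E h *m kerVec h = 0.
Proof.
move=> h0; apply/evolMx_kerP => //; rewrite !dofComp_vec /=.
rewrite -(scaler0 _ (2 / h)%:C); apply: stationaryZ.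
by apply: stat_stationary; rewrite ?sqrt3_sqr ?sqrt5_sqr ?sqrt3J ?sqrt5J ?hcosJ ?hsinJ ?hcossin.
Qed.

(** Subtracting the multiple of [kerVec] with the same mean of $u$ leaves a kernel vector of mean
    zero, which is zero by [stationary_unique]. *)
Lemma evolMx_ker_line h (q : 'cV[C]_(ndof 2)) : h != 0 ->
  cx h != 0 -> cy h != 0 -> sx h != 0 -> sy h != 0 ->
  kerVec h refDof 0 != 0 -> E h *m q = 0 ->
  q = (q refDof 0 / kerVec h refDof 0) *: kerVec h.
Proof.
move=> h0 cx0 cy0 sx0 sy0 r0 Eq; set z := _ / _.
pose q' := q - z *: kerVec h.
have Eq' : E h *m q' = 0 by rewrite mulmxBr Eq -scalemxAr kerVec_ker // scaler0 subrr.
have ref0 : dofComp q' o0 o0 o0 = 0.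
  by rewrite mxE /q' mxE [X in _ + X]mxE [X in _ - X]mxE /z divfK // subrr.
have [U0 V0 P0] := stationary_unique (@sqrt3_sqr R) (@sqrt5_sqr R) (@sqrt3J R) (@sqrt5J R)
  (hcosJ kx h) (hsinJ kx h) (hcossin kx h) (hcosJ ky h) (hsinJ ky h) (hcossin ky h)
  cx0 cy0 sx0 sy0 (proj1 (evolMx_kerP q' h0) Eq') ref0.
apply/eqP; rewrite -subr_eq0 -/q'; apply/eqP/dof_ext => m.
have -> : dofComp 0 m = 0 :> 'M[C]_3 by apply/matrixP => k l; rewrite !mxE.
by move: m; apply: ord3P.
Qed.

Lemma dim_mxker_evolMx h : h != 0 ->
  cx h != 0 -> cy h != 0 -> sx h != 0 -> sy h != 0 ->
  kerVec h refDof 0 != 0 -> \dim (mxker (E h)) = 1.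
Proof.
move=> h0 cx0 cy0 sx0 sy0 r0.
have -> : mxker (E h) = <[kerVec h]>%VS.
  apply/vspaceP => q; rewrite mem_mxker; apply/eqP/vlineP => [Eq|[z ->]].
    by exists (q refDof 0 / kerVec h refDof 0); exact: evolMx_ker_line.
  by rewrite -scalemxAr kerVec_ker // scaler0.
rewrite dim_vline; suff -> : kerVec h != 0 by [].
by apply: contra_neq r0 => ->; rewrite mxE.
Qed.

(** Common second-order approximation of the kernel vector and of the degrees of freedom of the
    plane wave. *)
Definition mode (k l m : 'I_3) h : C := Qhat kx ky m 0 * (mom1 kx k h * mom1 ky l h).

(** The factors $-\frac2hs_y$ and $\frac2hs_x$ tend to $-k_y$ and $k_x$, the components of $\hat Q$,
    while the profiles reproduce the moments of the wave. *)
Lemma kerVec_eqO2 k l m :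
  eqO2 (fun h => kerVec h (enum_rank (k, l, m)) 0) (mode k l m).
Proof.
move: m; apply: ord3P; rewrite /mode.
- have := eqO2M (eqO2_scale (-1) (hsin_eqO2 ky))
    (eqO2M (quadProfile_eqO2 kx k) (linProfile_eqO2 ky l)).
  apply: eqO2_eq => h; last by rewrite mxE /= rmorphN mulN1r.
  rewrite dofVecE [RHS]mxE [X in _ = _ * X]mxE.
  by rewrite mulN1r !mulNr mulrN -mulrA.
- have := eqO2M (hsin_eqO2 kx) (eqO2M (linProfile_eqO2 kx k) (quadProfile_eqO2 ky l)).
  apply: eqO2_eq => h; last by rewrite mxE.
  by rewrite dofVecE [RHS]mxE [X in _ = _ * X]mxE -mulrA.
- apply: eqO2_eq (eqO2_cst 0) => h; first by rewrite dofVecE mxE.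
  by rewrite mxE mul0r.
Qed.

Lemma dofMode_eqO2 k l m :
  eqO2 (fun h => dofMode (@basis2 R) kx ky h h (Qhat kx ky) (enum_rank (k, l, m)) 0)
    (mode k l m).
Proof.
have := eqO2_scale (Qhat kx ky m 0) (eqO2M (modeCoef_eqO2 kx k) (modeCoef_eqO2 ky l)).
apply: eqO2_eq => // h; rewrite dofModeE invfM rmorphM /=; ring.
Qed.
End Kernel.

(** * The projector and its accuracy *)

Theorem mainTheorem6 (R : realType) (kx ky : R) (hk : kx * ky != 0) :
  let E := fun h : R => evolMx (@basis2 R) 1%:M 1%:M kx ky h h in
  let DOF := fun h : R => dofMode (@basis2 R) kx ky h h (Qhat kx ky) in
  exists P : R -> 'cV[R[i]]_(ndof 2) -> 'cV[R[i]]_(ndof 2),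
    @selectively_optimal R 2 E P /\
    forall i : 'I_(ndof 2), isO_pow (fun h => (DOF h - P h (DOF h)) i 0) 2.
Proof.
move=> E DOF.
have [kx0 ky0] : kx != 0 /\ ky != 0.
  by move: hk; rewrite mulf_eq0 negb_or => /andP[].
pose r h := kerVec kx ky h.
have kyC : (- ky)%:C != 0 :> R[i] by rewrite (fmorph_eq0 (real_complex R)) oppr_eq0.
have near_cos (k : R) : \forall h \near 0^'+, hcos k h != 0.
  by apply: eqO2_near_neq0 (oner_neq0 _) (hcos_eqO2 k).
have near_sin (k : R) : k != 0 -> \forall h \near 0^'+, hsin k h != 0.
  move=> k0; have kC : k%:C != 0 :> R[i] by rewrite (fmorph_eq0 (real_complex R)).
  apply: filterS (eqO2_near_neq0 kC (hsin_eqO2 k)) => h.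
  by apply: contra_neq => ->; rewrite mulr0.
have ref_mode : mode kx ky o0 o0 o0 = fun=> (- ky)%:C.
  by apply/funext => h; rewrite /mode mxE /mom1 /= !mulr1.
have r_ref := kerVec_eqO2 kx ky o0 o0 o0; rewrite ref_mode in r_ref.
have near_ref : \forall h \near 0^'+, r h (refDof) 0 != 0.
  exact: eqO2_near_neq0 kyC r_ref.
(* Where the mean of $u$ of [r h] vanishes, division by zero yields 0 and the zero vector is still
   in the kernel; for small $h$ this mean is nonzero because $k_y\ne0$. *)
exists (fun h q => (q refDof 0 / r h refDof 0) *: r h); split; first split.
- move=> h h0 q; rewrite mem_mxker -scalemxAr kerVec_ker ?gt_eqF // scaler0.
  by [].
(* The kernel is a line for small $h$, so the index set has one element, and there the projector is
   exact. *)
- exists [set refDof]%SET; split.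
    near=> h; have h0 : 0 < h by [].
    have hn : h != 0 by rewrite gt_eqF.
    rewrite cards1 dim_mxker_evolMx //; near: h.
    + exact: near_cos.
    + exact: near_cos.
    + exact: near_sin.
    + exact: near_sin.
    + exact: near_ref.
  move=> i; rewrite inE => /eqP -> q.
  apply: (isO_pow_near _ (isO_pow0 R 3)); near=> h.
  by rewrite mxE divfK ?subrr //; near: h; exact: near_ref.
- move=> i; rewrite -(enum_valK i); case: (enum_val i) => [[k l] m].
  have r_kl := kerVec_eqO2 kx ky k l m.
  have D_kl := dofMode_eqO2 kx ky k l m.
  have D_ref := dofMode_eqO2 kx ky o0 o0 o0; rewrite ref_mode in D_ref.
  (* Both means of $u$ are $-k_y+O(h^2)$, so their quotient is $1+O(h^2)$ and rescaling keeps second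
     order. *)
  have P_kl := eqO2M (eqO2M D_ref (eqO2V kyC r_ref)) r_kl.
  have H : eqO2 (fun h => DOF h (enum_rank (k, l, m)) 0)
      (fun h => (DOF h refDof 0 / r h refDof 0) * r h (enum_rank (k, l, m)) 0).
    apply: eqO2_trans D_kl (eqO2_sym _); move: P_kl; apply: eqO2_eq => // h.
    by rewrite divff // mul1r.
  have [_ _] := H; apply: isO_pow_near; apply: nearW => h.
  by rewrite [RHS]mxE [X in _ = _ + X]mxE [X in _ = _ - X]mxE.
Unshelve. all: end_near.
Qed.
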